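(* Let $L$ be a triangulation of the $k$-dimensional simplex such that the only vertices of $L$ on the boundary of the simplex are the original vertices of the simplex, and such that $L$ has at least one vertex in the interior. The generalized Tchebyshev polynomials of the first kind satisfy $T^L_n(x)=x^n$ for $n\leq k$. For all $n\geq k+1$, the polynomial $T^L_n(x)$ satisfies a recurrence of the form $$T^L_n(x)=\sum_{j=1}^{k+1} p^L_j(x)\, T^L_{n-j}(x),$$ where each $p^L_j(x)$ is a polynomial of $x$ and equals the coefficient of $t^j$ in $$(-2t)^{k+1}\,r_L\!\left(-\frac{1+t}{2t},-\frac{1+x}{2}\right).$$
   Context: Simplicial complexes are finite abstract simplicial complexes, containing the empty face; $k\geq 1$. The link of a face $\sigma$ of $K$ is $\mathrm{link}_K(\sigma)=\{\tau\in K: \sigma\cap\tau=\emptyset,\ \sigma\cup\tau\in K\}$. $f_i(K)$ is the number of $i$-dimensional faces of $K$. The $F$-polynomial of $K$ is $F(K,x)=\sum_{j=0}^{\dim K+1} f_{j-1}(K)\left(\frac{x-1}{2}\right)^j$. $\partial(L)$ denotes the subcomplex of boundary faces of $L$, which is the boundary complex of the original $k$-simplex; $V(\partial(L))$ is its vertex set (the original vertices) and $V(\mathrm{Int}(L))$ is the set of vertices of $L$ lying in the interior. The magic polynomial of $L$ is $$r_L(u,v)=\sum_{\sigma\in L\setminus\partial(L)} u^{|\sigma\cap V(\partial(L))|}v^{|\sigma\cap V(\mathrm{Int}(L))|}-u^{k+1}.$$ A simplicial complex $K'$ is a generalized Tchebyshev triangulation of $K$ induced by $L$ if there is an ordered list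 $\sigma_1,\ldots,\sigma_m$ of the $k$-dimensional faces of $K$, listing each exactly once, bijections $\phi_{\sigma_i}:V(\partial(L))\to\sigma_i$, and simplicial complexes $K_0=K,K_1,\ldots,K_m=K'$ such that for each $i\geq 1$ the complex $K_i$ is obtained from $K_{i-1}$ as follows: take an isomorphic copy $L_i$ of $L$ in which each boundary vertex $w\in V(\partial(L))$ is identified with $\phi_{\sigma_i}(w)$ and the interior vertices are new vertices, and replace the family of faces $\{\sigma_i\cup\tau:\tau\in\mathrm{link}_{K_{i-1}}(\sigma_i)\}$ by the family $\{\sigma'\cup\tau:\sigma'\in L_i,\ \tau\in\mathrm{link}_{K_{i-1}}(\sigma_i)\}$. All generalized Tchebyshev triangulations of a given $K$ induced by $L$ have the same $f$-vector, hence the same $F$-polynomial, and there is a unique linear map $T^L:\mathbb{R}[x]\to\mathbb{R}[x]$ with $T^L(F(K,x))=F(K',x)$ for every simplicial complex $K$ and every generalized Tchebyshev triangulation $K'$ of $K$ induced by $L$. One defines $T^L_n(x):=T^L(x^n)$. *)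

(* Defs.v *)
From HB Require Import structures.
From mathcomp Require Import all_boot all_order all_algebra.
From mathcomp Require Import finmap.
From mathcomp Require Import boolp classical_sets reals.

Set Implicit Arguments.
Unset Strict Implicit.
Unset Printing Implicit Defensive.
Import GRing.Theory.
Local Open Scope fset_scope.
Local Open Scope ring_scope.

(* Simplicial complexes are finite and contain the empty face. *)

Definition simplicial_complex (V : choiceType) (K : {fset {fset V}}) : Prop :=
  fset0 \in K /\
  forall sigma tau : {fset V}, sigma \in K -> tau `<=` sigma -> tau \in K.

Definition vertices (V : choiceType) (K : {fset {fset V}}) : {fset V} :=
  \bigcup_(sigma <- K) sigma.

Definition link (V : choiceType) (K : {fset {fset V}}) (sigma : {fset V}) :
    {fset {fset V}} :=
  [fset tau in K | (sigma `&` tau == fset0) && (sigma `|` tau \in K)].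

(* The faces of dimension j - 1, that is, with j vertices. *)
Definition faces_card (V : choiceType) (K : {fset {fset V}}) (j : nat) :
    {fset {fset V}} :=
  [fset sigma in K | #|` sigma| == j].

(* \max_(sigma <- K) #|` sigma| is dim K + 1. *)
Definition Fpoly (R : realType) (V : choiceType) (K : {fset {fset V}}) :
    {poly R} :=
  \sum_(0 <= j < (\max_(sigma <- K) #|` sigma|).+1)
    #|` faces_card K j|%:R *: (2^-1 *: ('X - 1)) ^+ j.

(* The k-dimensional simplex is the standard one in R^(k+1), so the
   coordinates of its points are their barycentric coordinates. *)

Section Simplex.
Variables (R : realType) (n : nat).
Implicit Types (x : 'rV[R]_n) (sigma : {fset 'rV[R]_n}).

Definition std_simplex : set 'rV[R]_n :=
  [set x | (forall i, 0 <= x 0 i) /\ \sum_(i < n) x 0 i = 1].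

Definition simplex_boundary : set 'rV[R]_n :=
  [set x | std_simplex x /\ exists i, x 0 i = 0].

Definition simplex_interior : set 'rV[R]_n :=
  [set x | std_simplex x /\ forall i, 0 < x 0 i].

Definition affinely_independent sigma : Prop :=
  forall c : 'rV[R]_n -> R,
    \sum_(v <- sigma) c v = 0 -> \sum_(v <- sigma) c v *: v = 0 ->
    forall v, v \in sigma -> c v = 0.

Definition convex_hull sigma : set 'rV[R]_n :=
  [set x | exists c : 'rV[R]_n -> R,
     [/\ forall v, v \in sigma -> 0 <= c v,
         \sum_(v <- sigma) c v = 1 &
         x = \sum_(v <- sigma) c v *: v]].

End Simplex.

(* A triangulation is a geometric simplicial complex, given by the vertex sets
   of its faces, whose faces cover exactly the simplex. *)
Definition simplex_triangulation (R : realType) (k : nat)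
    (L : {fset {fset 'rV[R]_k.+1}}) : Prop :=
  [/\ simplicial_complex L,
      forall sigma, sigma \in L -> affinely_independent sigma,
      forall sigma tau, sigma \in L -> tau \in L ->
        (convex_hull sigma `&` convex_hull tau
          = convex_hull (sigma `&` tau)%fset)%classic &
      (\bigcup_(sigma in [set` L]) convex_hull sigma
        = @std_simplex R k.+1)%classic].

Section MagicPolynomial.
Variables (R : realType) (k : nat) (L : {fset {fset 'rV[R]_k.+1}}).

Definition boundary_complex : {fset {fset 'rV[R]_k.+1}} :=
  [fset sigma in L |
    `[< (convex_hull sigma `<=` @simplex_boundary R k.+1)%classic >]].

Definition interior_vertices : {fset 'rV[R]_k.+1} :=
  [fset v in vertices L | `[< simplex_interior v >]].

(* The value r_L(u, v) at elements u, v of any commutative ring. *)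
Definition magic_poly (A : comNzRingType) (u v : A) : A :=
  \sum_(sigma <- L `\` boundary_complex)
     u ^+ #|` sigma `&` vertices boundary_complex|
     * v ^+ #|` sigma `&` interior_vertices|
  - u ^+ k.+1.

(* One subdivision step. The map psi carries L to its copy L_i, and its
   restriction to the boundary vertices is the bijection phi onto sigma; only
   the values of psi on the vertices of L matter. *)
Definition tchebyshev_step (V : choiceType) (K : {fset {fset V}})
    (sigma : {fset V}) (K' : {fset {fset V}}) : Prop :=
  exists psi : 'rV[R]_k.+1 -> V,
    [/\ {in vertices L &, injective psi},
        psi @` vertices boundary_complex = sigma,
        forall w, w \in interior_vertices -> psi w \notin vertices K &
        K' = (K `\` [fset sigma `|` tau | tau in link K sigma])
             `|` [fset (psi @` sigma') `|` tau
                   | sigma' : {fset 'rV[R]_k.+1} in L,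
                     tau : {fset V} in link K sigma]].

Definition tchebyshev_triangulation (V : choiceType)
    (K K' : {fset {fset V}}) : Prop :=
  exists (s : seq {fset V}) (Ks : nat -> {fset {fset V}}),
    [/\ uniq s /\ s =i faces_card K k.+1,
        Ks 0%N = K /\ Ks (size s) = K',
        forall i, (i <= size s)%N -> simplicial_complex (Ks i) &
        forall i, (i < size s)%N ->
          tchebyshev_step (Ks i) (nth fset0 s i) (Ks i.+1)].

Definition is_tchebyshev_map (T : {poly R} -> {poly R}) : Prop :=
  (forall (a : R) (p q : {poly R}), T (a *: p + q) = a *: T p + T q) /\
  forall (V : choiceType) (K K' : {fset {fset V}}),
    simplicial_complex K -> tchebyshev_triangulation K K' ->
    T (Fpoly R K) = Fpoly R K'.

(* T^L is the unique linear map satisfying is_tchebyshev_map; idfun is only a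
   default in case there is none. *)
Definition tchebyshev_map : {poly R} -> {poly R} :=
  if pselect (exists T, is_tchebyshev_map T) is left T_exists
  then projT1 (cid T_exists) else idfun.

Definition tchebyshev_poly (n : nat) : {poly R} := tchebyshev_map 'X^n.

End MagicPolynomial.

(* Main.v *)
Require Import Defs.
From HB Require Import structures.
From mathcomp Require Import all_boot all_order all_algebra.
From mathcomp Require Import finmap.
From mathcomp Require Import boolp classical_sets reals.
From mathcomp Require Import ring lra zify.
Import Order.TTheory GRing.Theory Num.Theory.
Import Pdiv.Ring Pdiv.RingMonic.
Set Implicit Arguments.
Unset Strict Implicit.
Unset Printing Implicit Defensive.
Local Open Scope fset_scope.
Local Open Scope ring_scope.

(** Write [y = (x - 1) / 2], so that the F-polynomial of [K] is the sum of
    [y ^+ #|rho|] over the faces [rho].  A subdivision step trades every face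
    [sigma `|` tau] for the faces [sigma' `|` tau] with [sigma'] an interior face
    of [L], and [magic_poly L u v] is the resulting change, for each
    [tau], in a generating function that counts old vertices by [u] and new ones
    by [v].

    The number of faces after all the steps seems to depend on their order, and
    the way around this is an invariant.  Let polynomials [P n] satisfy
    [P n = y ^+ n] for [n <= k] and
      [P (k.+1 + m) = sum_(s interior face)
                         y ^+ #|new part of s| * P (#|old part of s| + m)].
    Then the sum over the faces [rho] of [y ^+ #|rho \ V0| * P #|rho & V0|], where
    [V0] is the original vertex set, is the same before and after every step.
    At the start no face has a new vertex and this is the sum of [P #|rho|]; at
    the end no face contains an original [k]-face, so at most [k] of its vertices
    are old and the sum is the F-polynomial of the triangulation
    ([triangulation_sum]).  Hence the linear map [y ^+ n |-> P n] is [T^L].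

    The recurrence for [P] says that this map kills the multiples of the magic
    polynomial.  With an auxiliary variable [w] over [R[x]] and
    [G(w) = - 2 ^+ k.+1 * r_L((w - 1) / 2, (x - 1) / 2)], which is monic of degree
    [k.+1] in [w], the map is: replace [x] by [w], take the remainder modulo
    [G(w)], set [w = x] ([reduce_map]).  Applying it to [w ^+ (n - k.+1) * G(w)]
    gives the recurrence, whose coefficients are those of [G] in reverse order.
    Full simplices, with F-polynomials [((1 + x) / 2) ^+ n], span the polynomials,
    so no other linear map has the defining property of [T^L].

    Reversing [G] produces [(2 t) ^+ k.+1 * r_L((1 - t) / (2 t), (x - 1) / 2)],
    whereas the arguments of the expression sought are [-1 - u] and [-1 - v] for
    these [u] and [v].  The two agree by a Dehn-Sommerville symmetry,
    [r_L(-1 - u, -1 - v) = (-1) ^+ k.+1 * r_L(u, v)] ([magic_poly_symmetry]).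
    Expanding its left side reduces it to: for every face [tau] of [L], the
    interior faces [sigma] containing [tau] satisfy
    [sum (-1) ^+ #|sigma| = (-1) ^+ k.+1] ([interior_star_euler]).  This is
    geometric.  At the point sum of the vertices of [tau], the tangent cones of
    these [sigma] (in the cone over the simplex, so that [tau] may be empty)
    partition an open convex cone, and the Euler characteristic
    [P |-> (-1) ^+ dim P] is additive on relatively open convex sets
    ([euler_relation]). *)

(** * Euler relations between relatively open convex sets *)

Lemma uniform_small (R : realType) (T : eqType) (r : seq T)
    (P : T -> R -> Prop) :
  (forall i, i \in r ->
     exists2 d, 0 < d & forall s, 0 < s -> s <= d -> P i s) ->
  exists2 d, 0 < d & forall s, 0 < s -> s <= d -> forall i, i \in r -> P i s.
Proof.
elim: r => [_|i r IH H]; first by exists 1.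
have [d d0 Hd] : exists2 d, 0 < d & forall s, 0 < s -> s <= d ->
    forall i, i \in r -> P i s.
  by apply: IH => j jr; apply: H; rewrite inE jr orbT.
have [e e0 He] := H i (mem_head _ _).
exists (Num.min d e); first by rewrite lt_min d0.
move=> s s0; rewrite le_min => /andP[sd se] j.
by rewrite inE => /orP[/eqP->|jr]; [apply: He | apply: Hd].
Qed.

Section Line.
Variables (R : realType) (A : nzRingType).

(** The two kinds of relatively open convex subsets of the line: nonempty open
    intervals, bounded or not ([op]), and points. *)
Definition line_cell (op : bool) (I : set R) : Prop :=
  [/\ exists t, I t,
      forall s t u, I s -> I u -> s <= t -> t <= u -> I t &
      if op then forall t, I t ->
        exists2 d, 0 < d & forall s, - d <= s -> s <= d -> I (t + s)
      else forall s t, I s -> I t -> s = t].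

Definition ind (P : Prop) : A := (`[< P >])%:R.

Lemma indT (P : Prop) : P -> ind P = 1.
Proof. by move=> p; rewrite /ind (asboolT p). Qed.

Lemma indF (P : Prop) : ~ P -> ind P = 0.
Proof. by move=> p; rewrite /ind (asboolF p). Qed.

(** For an interval the indicator jumps just to the right of [t] exactly when
    [t] is its left endpoint; for a point it drops right after the point. *)
Lemma line_cell_right op I t : line_cell op I ->
  exists2 d, 0 < d & forall s, 0 < s -> s <= d ->
    ind (I t) - ind (I (t + s)) =
    (-1) ^+ op * ind ((~~ op \/ has_lbound I) /\ t = inf I).
Proof.
case=> [[b Ib] cvx]; case: op => [opI|sing].
  case: (pselect (I t)) => [It|nIt].
    have [d d0 Hd] := opI t It; exists d => // s s0 sd.
    have Its : I (t + s) by apply: Hd; lra.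
    rewrite (indT It) (indT Its) indF ?mulr0 ?subrr // => -[[//|lbI] tE].
    have : I (t + - d) by apply: Hd; lra.
    move=> /(ge_inf lbI); rewrite -tE; lra.
  case: (pselect (has_lbound I /\ t = inf I)) => [[lbI tE]|nE].
    have tb : t < b.
      have := ge_inf lbI Ib; rewrite -tE le_eqVlt => /orP[/eqP tb|//].
      by rewrite tb in nIt.
    exists (b - t); first lra.
    move=> s s0 sd; rewrite (indF nIt) [X in _ * X]indT ?mulr1; last first.
      by split=> //; right.
    rewrite indT ?sub0r ?expr1 //.
    have [c Ic] : exists2 c, I c & c < t + s.
      apply: inf_lt; [by exists b | rewrite -tE; lra].
    by move=> cts; apply: (cvx c _ b) => //; lra.
  case: (pselect (exists2 c, I c & c <= t)) => [[c Ic ct]|nlb].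
    exists 1 => // s s0 _; rewrite !indF ?mulr0 ?subrr //.
      by case=> [[//|lbI] tE]; apply: nE.
    by move=> Its; apply: nIt; apply: (cvx c _ (t + s)) => //; lra.
  have lbI : has_lbound I.
    exists t => x Ix; rewrite leNgt; apply/negP => xt.
    by apply: nlb; exists x => //; lra.
  have tlt : t < inf I.
    have : t <= inf I.
      apply: lb_le_inf; first by exists b.
      move=> x Ix; rewrite leNgt; apply/negP => xt.
      by apply: nlb; exists x => //; lra.
    by rewrite le_eqVlt => /orP[/eqP tE|//]; case: nE.
  exists ((inf I - t) / 2); first lra.
  move=> s s0 sd; rewrite !indF ?mulr0 ?subrr //.
    by case=> _ tE; lra.
  by move=> /(ge_inf lbI); lra.
have IE x : I x -> x = b by move=> Ix; apply: sing.
have infE : inf I = b.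
  suff -> : I = [set b]%classic by rewrite inf1.
  by apply/seteqP; split=> x /= => [/IE|->//].
rewrite infE; case: (ltgtP t b) => tb.
- exists ((b - t) / 2); first lra.
  move=> s s0 sd; rewrite !indF ?mulr0 ?subrr //.
  + by move=> [_ tE]; lra.
  + by move=> /IE; lra.
  + by move=> /IE; lra.
- exists 1 => // s s0 sd; rewrite !indF ?mulr0 ?subrr //.
  + by move=> [_ tE]; lra.
  + by move=> /IE; lra.
  + by move=> /IE; lra.
- exists 1 => // s s0 sd.
  rewrite tb (indT Ib) indF ?subr0; last by move=> /IE; lra.
  by rewrite indT ?mul1r //; split => //; left.
Qed.

Lemma line_cell_left op I : line_cell op I ->
  exists2 d, 0 < d & forall s, 0 < s -> s <= d ->
    ind (I (- s^-1)) = ind (op /\ ~ has_lbound I).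
Proof.
case=> [[b Ib] cvx] opI; case: (pselect (has_lbound I)) => [lbI|nlb].
  have [c cI] := lbI.
  exists (`|c| + 1)^-1; first by rewrite invr_gt0; have := normr_ge0 c; lra.
  move=> s s0; rewrite -[X in X <= _]invrK lef_pV2 ?posrE ?invr_gt0 //; last first.
    by have := normr_ge0 c; lra.
  move=> sc; rewrite !indF // => [[]//|/cI].
  have := ler_norm (- c); rewrite normrN; lra.
case: op opI => opI; last first.
  by case: nlb; exists b => x Ix; rewrite (opI _ _ Ix Ib).
exists (`|b| + 1)^-1; first by rewrite invr_gt0; have := normr_ge0 b; lra.
move=> s s0; rewrite -[X in X <= _]invrK lef_pV2 ?posrE ?invr_gt0 //; last first.
  by have := normr_ge0 b; lra.
move=> sb; rewrite !indT //.
case: (pselect (exists2 c, I c & c <= - s^-1)) => [[c Ic cs]|nc].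
  by apply: (cvx c _ b) => //; have := ler_norm (- b); rewrite normrN; lra.
case: nlb; exists (- s^-1) => x Ix; rewrite leNgt; apply/negP => xt.
by apply: nc; exists x => //; lra.
Qed.

(** The functional
      [g |-> sum_t (g(t) - g(t+)) - g(-oo)]
    takes the value [1] on the indicator of a point and [-1] on that of an
    open interval, whether or not the interval has a left endpoint.  The
    limits are those of finitely many step functions, so they are values at [t
    + s] and at [- s^-1] for one small [s], which makes linearity obvious. *)
Lemma line_euler_relation (T : eqType) (r : seq T) (a : T -> A)
    (op : T -> bool) (I : T -> set R) :
  (forall i, i \in r -> line_cell (op i) (I i)) ->
  (forall t, \sum_(i <- r) a i * ind (I i t) = 0) ->
  \sum_(i <- r) a i * (-1) ^+ op i = 0.
Proof.
move=> cellI sumI.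
(* Indicators of the family can jump on the right only at infima.  The infimum
   of an interval unbounded below is a junk value, at which nothing jumps. *)
pose E := undup [seq inf (I i) | i <- r].
have [d1 d10 H1] := uniform_small (fun i ir => line_cell_left (cellI i ir)).
have [|d2 d20 H2] := @uniform_small R R E (fun t s => forall i, i \in r ->
    ind (I i t) - ind (I i (t + s)) =
    (-1) ^+ op i * ind ((~~ op i \/ has_lbound (I i)) /\ t = inf (I i))).
  move=> t _.
  exact: (uniform_small (fun i ir => line_cell_right t (cellI i ir))).
pose s := Num.min d1 d2.
have s0 : 0 < s by rewrite lt_min d10.
have sd1 : s <= d1 by rewrite ge_min lexx.
have sd2 : s <= d2 by rewrite ge_min lexx orbT.
have {}H1 := H1 s s0 sd1.
have {}H2 := H2 s s0 sd2.
have : \sum_(i <- r) a i * (\sum_(t <- E) (ind (I i t) - ind (I i (t + s)))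
         - ind (I i (- s^-1))) = 0.
  under eq_bigr => i _ do rewrite mulrBr mulr_sumr.
  rewrite sumrB sumI subr0 exchange_big big1 // => t _.
  under eq_bigr => i _ do rewrite mulrBr.
  by rewrite sumrB !sumI subrr.
move=> sum0; rewrite -[RHS]sum0; apply: eq_big_seq => i ir.
congr (_ * _); rewrite H1 //.
have iE : inf (I i) \in E.
  by rewrite mem_undup; apply/mapP; exists i.
rewrite (eq_big_seq _ (fun t tE => H2 t tE i ir)).
rewrite (bigD1_seq _ iE) ?undup_uniq //= big1 ?addr0; last first.
  by move=> t tn; rewrite indF ?mulr0 // => -[_ tE]; rewrite tE eqxx in tn.
case: (op i) => /=.
  case: (pselect (has_lbound (I i))) => lb.
    by rewrite indT ?indF ?mulr1 ?subr0 //; [case | split=> //; right].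
  rewrite indF ?indT ?mulr0 ?sub0r //; by case=> [[]].
by rewrite indT ?indF ?mulr1 ?subr0 //; [case | split=> //; left].
Qed.

End Line.

Section RelativelyOpen.
Variables (R : realType) (n : nat).
Implicit Types (W : {vspace 'rV[R]_n}) (P : set 'rV[R]_n).

(** [W] is the direction space of the affine hull of [P], so [\dim W] is the
    dimension of [P]. *)
Definition relopen W P : Prop :=
  [/\ exists x, P x,
      forall x y, P x -> P y -> x - y \in W,
      forall x y s, P x -> P y -> 0 <= s -> s <= 1 ->
        P (x + s *: (y - x)) &
      forall x w, P x -> w \in W ->
        exists2 d, 0 < d & forall s, - d <= s -> s <= d -> P (x + s *: w)].

Definition coordf (j : 'I_n) : 'Hom('rV[R]_n, 'M[R]_1) :=
  linfun (mulmxr (delta_mx j 0)).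

Lemma coordfE j x : coordf j x = (x 0 j)%:M.
Proof.
rewrite lfunE /=; apply/matrixP => a b; rewrite !ord1 !mxE eqxx mulr1n.
rewrite (bigD1 j) //= big1 ?addr0 ?mxE ?eqxx ?mulr1 // => l lj.
by rewrite mxE (negPf lj) mulr0.
Qed.

Lemma memv_ker_coordf j x : (x \in lker (coordf j)) = (x 0 j == 0).
Proof.
rewrite memv_ker coordfE; apply/eqP/eqP => [/matrixP/(_ 0 0)|->].
  by rewrite !mxE eqxx mulr1n.
by apply/matrixP => a b; rewrite !mxE mul0rn.
Qed.

Definition slice P j t : set 'rV[R]_n := [set x | P x /\ x 0 j = t].

Lemma relopen_slice W P j t : relopen W P -> (exists x, slice P j t x) ->
  relopen (W :&: lker (coordf j)) (slice P j t).
Proof.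
case=> [_ dirP cvxP opP] neS; split=> //.
- move=> x y [Px xt] [Py yt]; rewrite memv_cap dirP // memv_ker_coordf.
  by rewrite !mxE xt yt subrr eqxx.
- move=> x y s [Px xt] [Py yt] s0 s1; split; first exact: cvxP.
  by rewrite !mxE xt yt subrr mulr0 addr0.
- move=> x w [Px xt]; rewrite memv_cap memv_ker_coordf => /andP[wW /eqP w0].
  have [d d0 Hd] := opP x w Px wW; exists d => // s s1 s2; split; first exact: Hd.
  by rewrite !mxE xt w0 mulr0 addr0.
Qed.

(** A coordinate is a linear form, so it drops the dimension by at most one. *)
Lemma dim_coordf W j : \dim (coordf j @: W) = (W :&: lker (coordf j) != W)%VS.
Proof.
have := limg_ker_dim (coordf j) W; case: eqVneq => [-> /eqP|neW dimW].
  by rewrite -[X in _ == X]addn0 eqn_add2l => /eqP.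
apply/eqP; rewrite eqn_leq; apply/andP; split.
  by apply: leq_trans (dimvS (subvf _)) _; rewrite dimvf.
rewrite lt0n; apply: contraNneq neW => d0.
rewrite d0 addn0 in dimW.
by rewrite eqEdim capvSl /= dimW.
Qed.

Lemma relopen_cell W P j : relopen W P ->
  line_cell (W :&: lker (coordf j) != W)%VS [set t | exists x, slice P j t x].
Proof.
case=> [[x0 Px0] dirP cvxP opP]; split.
- by exists (x0 0 j), x0.
- move=> s t u [x [Px xs]] [y [Py yu]] st tu.
  have [su|su] := eqVneq s u.
    by exists x; split => //; apply/eqP; rewrite eq_le xs st su tu.
  have su' : s < u by rewrite lt_neqAle su (le_trans st tu).
  exists (x + ((t - s) / (u - s)) *: (y - x)); split.
    apply: cvxP => //; first by apply: divr_ge0; lra.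
    by rewrite ler_pdivrMr; lra.
  by rewrite !mxE xs yu; field; lra.
- case: eqVneq => [WE|WE].
    move=> s t [x [Px xs]] [y [Py yt]].
    have := dirP _ _ Px Py; rewrite -WE memv_cap memv_ker_coordf => /andP[_].
    by rewrite !mxE xs yt subr_eq0 => /eqP.
  have [w wW wj] : exists2 w, w \in W & w 0 j != 0.
    apply/not_exists2P => H; case/negP: WE; rewrite eqEsubv capvSl /=.
    apply/subvP => w wW; rewrite memv_cap wW memv_ker_coordf.
    by case: (H w) => // /negP; rewrite negbK.
  move=> t [x [Px xt]].
  have [d d0 Hd] := opP x ((w 0 j)^-1 *: w) Px (memvZ _ wW).
  exists d => // s s1 s2; exists (x + s *: ((w 0 j)^-1 *: w)).
  by split; [apply: Hd | rewrite !mxE mulVf // mulr1 xt].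
Qed.

(** Slice by the coordinate of index [m]: each slice of the family satisfies
    the relation by induction, and the values [t] for which a member has a
    nonempty slice form a point or an open interval, so that the relation on
    the line adds up the slices.  The missing sign [-1] for an interval
    accounts for the dimension lost by slicing. *)
Lemma euler_relation_flat (A : nzRingType) (T : eqType) (m : nat) :
  forall (y : 'rV[R]_n) (r : seq T) (a : T -> A)
    (W : T -> {vspace 'rV[R]_n}) (P : T -> set 'rV[R]_n),
  (forall i, i \in r -> relopen (W i) (P i)) ->
  (forall i, i \in r -> forall x, P i x ->
     forall j : 'I_n, (m <= j)%N -> x 0 j = y 0 j) ->
  (forall x, \sum_(i <- r) a i * ind A (P i x) = 0) ->
  \sum_(i <- r) a i * (-1) ^+ \dim (W i) = 0.
Proof.
elim: m => [|m IH] y r a W P opP flatP sumP.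
  have Py i x : i \in r -> P i x -> x = y.
    by move=> ir Px; apply/rowP => j; rewrite (flatP i ir x Px).
  rewrite -[RHS](sumP y); apply: eq_big_seq => i ir.
  have [[x Px] _ _ opPi] := opP i ir.
  have <- := Py _ _ ir Px; rewrite indT //; congr (_ * _).
  suff /eqP-> : \dim (W i) == 0%N by [].
  rewrite dimv_eq0 -subv0; apply/subvP => w wW; rewrite memv0.
  have [d d0 Hd] := opPi x w Px wW.
  have Pd : P i (x + d *: w) by apply: Hd; lra.
  move: Pd => /(Py _ _ ir); rewrite (Py _ _ ir Px) => /eqP.
  by rewrite -subr_eq0 addrAC subrr add0r scaler_eq0 gt_eqF.
have [mn|nm] := ltnP m n; last first.
  apply: (IH y r a W P) => // i ir x Px j mj.
  by have := ltn_ord j; rewrite ltnNge (leq_trans nm).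
pose j := Ordinal mn.
pose I i := [set t | exists x, slice (P i) j t x]%classic.
pose op i := (W i :&: lker (coordf j) != W i)%VS.
have dimE i : \dim (W i) = (\dim (W i :&: lker (coordf j)) + op i)%N.
  by rewrite /op -dim_coordf limg_ker_dim.
under eq_bigr => i _ do rewrite dimE exprD mulrA.
apply: (@line_euler_relation R A T r _ op I).
  by move=> i ir; apply: relopen_cell; apply: opP.
move=> t.
transitivity (\sum_(i <- [seq i <- r | `[< I i t >]])
    a i * (-1) ^+ \dim (W i :&: lker (coordf j))).
  rewrite big_filter [RHS]big_mkcond; apply: eq_bigr => i _.
  by rewrite /ind; case: asboolP; rewrite ?mulr1 ?mulr0.
apply: (IH (\row_l if l == j then t else y 0 l) _ a _
          (fun i => slice (P i) j t)).
- move=> i; rewrite mem_filter => /andP[/asboolP It ir].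
  by apply: relopen_slice => //; apply: opP.
- move=> i; rewrite mem_filter => /andP[_ ir] x [Px xt] l ml.
  rewrite mxE; case: eqVneq => [->//|lj].
  apply: (flatP i ir x Px l); rewrite ltn_neqAle ml andbT.
  by apply: contraNneq lj => ml'; apply/eqP/val_inj.
- move=> x; rewrite big_filter.
  have [xt|xt] := eqVneq (x 0 j) t; last first.
    rewrite big1 // => i _; rewrite indF ?mulr0 // => -[_ xt'].
    by rewrite xt' eqxx in xt.
  rewrite -[RHS](sumP x) big_mkcond; apply: eq_bigr => i _.
  case: asboolP => It.
    congr (_ * _); rewrite /ind /slice /= xt; congr (nat_of_bool _)%:R.
    by apply: asbool_equiv_eq; split=> [[]|].
  by rewrite indF ?mulr0 // => Px; apply: It; exists x.
Qed.

Lemma euler_relation (A : nzRingType) (T : eqType) (r : seq T) (a : T -> A)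
    (W : T -> {vspace 'rV[R]_n}) (P : T -> set 'rV[R]_n) :
  (forall i, i \in r -> relopen (W i) (P i)) ->
  (forall x, \sum_(i <- r) a i * ind A (P i x) = 0) ->
  \sum_(i <- r) a i * (-1) ^+ \dim (W i) = 0.
Proof.
move=> opP; apply: (@euler_relation_flat A T n 0) opP _ => i _ x _ j.
by rewrite leqNgt ltn_ord.
Qed.

End RelativelyOpen.

(** * Cones over the faces of a triangulation *)

Lemma small_perturbation (R : realType) (c e : R) : 0 < c ->
  exists2 d, 0 < d & forall s, 0 < s -> s <= d ->
    forall r, - s <= r -> r <= s -> 0 < c + r * e.
Proof.
move=> c0; have e0 := normr_ge0 e.
have e1 : 0 < `|e| + 1 by lra.
exists (c / (`|e| + 1)); first exact: divr_gt0.
move=> s s0 sd r r1 r2.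
have rs : `|r| <= c / (`|e| + 1) by rewrite ler_norml; lra.
have re : `|r * e| < c.
  rewrite normrM; apply: le_lt_trans (ler_wpM2r e0 rs) _.
  by rewrite mulrAC ltr_pdivrMr // ltr_pM2l //; lra.
by move: re; rewrite ltr_norml => /andP[]; lra.
Qed.

Section Cones.
Variables (R : realType) (n : nat).
Implicit Types (sigma tau : {fset 'rV[R]_n}).

Definition lin_indep sigma : Prop := forall c : 'rV[R]_n -> R,
  \sum_(v <- sigma) c v *: v = 0 -> forall v, v \in sigma -> c v = 0.

Lemma lin_indep_free sigma : lin_indep sigma -> free sigma.
Proof.
move=> indep; rewrite -[X in free X]in_tupleE; apply/freeP => c c0 i.
pose c' v := oapp c 0 (insub (index v sigma)).
have c'E (j : 'I_(size sigma)) : c' sigma`_j = c j.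
  by rewrite /c' index_uniq ?fset_uniq // valK.
rewrite -c'E; apply: indep; last by rewrite mem_nth.
rewrite (big_nth 0) big_mkord -[RHS]c0; apply: eq_bigr => j _.
by rewrite c'E.
Qed.

Lemma lin_indep_eq sigma (c d : 'rV[R]_n -> R) : lin_indep sigma ->
  \sum_(v <- sigma) c v *: v = \sum_(v <- sigma) d v *: v ->
  forall v, v \in sigma -> c v = d v.
Proof.
move=> indep cd v vs; apply/eqP; rewrite -subr_eq0; apply/eqP.
apply: (indep (fun v => c v - d v)) vs.
by under eq_bigr => w _ do rewrite scalerBl; rewrite sumrB cd subrr.
Qed.

Definition open_cone sigma : set 'rV[R]_n :=
  [set x | exists2 c : 'rV[R]_n -> R, (forall v, v \in sigma -> 0 < c v) &
     x = \sum_(v <- sigma) c v *: v].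

Lemma sum_sub_face sigma tau (c : 'rV[R]_n -> R) : tau `<=` sigma ->
  \sum_(v <- tau) c v *: v =
  \sum_(v <- sigma) (if v \in tau then c v else 0) *: v.
Proof.
move=> ts; rewrite -(big_fset_incl _ ts) /=; last first.
  by move=> v _ /negPf->; rewrite scale0r.
by apply: eq_big_seq => v ->.
Qed.

Lemma open_coneD sigma tau x (a b : R) : tau `<=` sigma -> open_cone sigma x ->
  0 < a -> 0 <= b -> open_cone sigma (a *: x + b *: \sum_(v <- tau) v).
Proof.
move=> ts [c c0 ->] a0 b0.
exists (fun v => a * c v + b * (if v \in tau then 1 else 0)).
  move=> v vs; apply: ltr_pwDl; first by rewrite mulr_gt0 ?c0.
  by case: ifP; rewrite ?mulr1 ?mulr0.
have -> : \sum_(v <- tau) v = \sum_(v <- tau) 1 *: v.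
  by apply: eq_bigr => v _; rewrite scale1r.
rewrite (sum_sub_face (fun=> 1) ts) !scaler_sumr -big_split /=.
by apply: eq_bigr => v _; rewrite scalerDl !scalerA.
Qed.

Lemma open_cone_convex sigma x y (s : R) : open_cone sigma x ->
  open_cone sigma y -> 0 <= s -> s <= 1 -> open_cone sigma (x + s *: (y - x)).
Proof.
move=> [c c0 ->] [d d0 ->] s0 s1.
exists (fun v => c v + s * (d v - c v)).
  move=> v vs; have := c0 v vs; have := d0 v vs; nra.
rewrite -sumrB scaler_sumr -big_split /=; apply: eq_bigr => v _.
by rewrite scalerDl -scalerBl scalerA.
Qed.

Lemma open_cone_span sigma x : open_cone sigma x -> x \in <<sigma>>%VS.
Proof.
case=> c _ ->; rewrite big_seq; apply: memv_suml => v vs.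
by apply/memvZ/memv_span.
Qed.

(** For [tau] a subset of [sigma] and [p] the sum of the vertices of [tau],
    this is the cone of combinations of [sigma] with positive coefficients
    outside [tau] and arbitrary ones in [tau]. *)
Definition tangent_cone sigma (p : 'rV[R]_n) : set 'rV[R]_n :=
  [set x | exists2 d, 0 < d & open_cone sigma (p + d *: x)].

Lemma scale_toward (p x : 'rV[R]_n) (s d : R) : 0 < d ->
  p + s *: x = (s / d) *: (p + d *: x) + (1 - s / d) *: p.
Proof.
move=> d0; apply/rowP => i; rewrite !mxE; field; lra.
Qed.

(** The segment from a point of the open cone of [sigma] towards [p] stays in
    that cone, so that one small [d] gives all smaller ones. *)
Lemma tangent_cone_small sigma tau x : tau `<=` sigma ->
  tangent_cone sigma (\sum_(v <- tau) v) x ->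
  exists2 d, 0 < d & forall s, 0 < s -> s <= d ->
    open_cone sigma (\sum_(v <- tau) v + s *: x).
Proof.
move=> ts [d d0 dP]; exists d => // s s0 sd.
rewrite (scale_toward _ _ s d0); apply: open_coneD => //; first exact: divr_gt0.
by rewrite subr_ge0 ler_pdivrMr // mul1r.
Qed.

Lemma relopen_tangent_cone sigma tau : lin_indep sigma -> tau `<=` sigma ->
  relopen <<sigma>> (tangent_cone sigma (\sum_(v <- tau) v)).
Proof.
move=> indep ts; set p := \sum_(v <- tau) v.
have pin : p \in <<sigma>>%VS.
  rewrite /p big_seq; apply: memv_suml => v vt.
  by apply/memv_span; apply: (fsubsetP ts).
have dir x : tangent_cone sigma p x -> x \in <<sigma>>%VS.
  case=> d d0 /open_cone_span.
  by rewrite rpredDl // rpredZeq gt_eqF.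
split.
- exists (\sum_(v <- sigma) v); exists 1 => //; rewrite scale1r.
  rewrite addrC -[X in X + _]scale1r -[X in _ + X]scale1r.
  apply: open_coneD => //; exists (fun=> 1) => //.
  by apply: eq_bigr => v _; rewrite scale1r.
- by move=> x y /dir xs /dir ys; apply: memvB.
- move=> x y s /(tangent_cone_small ts)[d d0 dP].
  move=> /(tangent_cone_small ts)[e e0 eP] s0 s1.
  exists (Num.min d e); first by rewrite lt_min d0.
  set m := Num.min d e; have m0 : 0 < m by rewrite lt_min d0.
  have -> : p + m *: (x + s *: (y - x)) =
      (p + m *: x) + s *: ((p + m *: y) - (p + m *: x)).
    by apply/rowP => i; rewrite !mxE; ring.
  apply: open_cone_convex => //; first by apply: dP; rewrite // ge_min lexx.
  by apply: eP; rewrite // ge_min lexx orbT.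
- move=> x w [d d0 [c c0 xE]] ws.
  have [e wE _] := free_span (lin_indep_free indep) ws.
  have [|m m0 mP] := @uniform_small R _ sigma
      (fun v s => forall r, - s <= r -> r <= s -> 0 < c v + r * (d * e v)).
    by move=> v /c0 cv0; apply: small_perturbation.
  exists m => // s s1 s2; exists d => //.
  exists (fun v => c v + s * (d * e v)).
    by move=> v vs; apply: (mP m).
  rewrite scalerDr addrA xE scalerA wE scaler_sumr -big_split /=.
  by apply: eq_bigr => v _; rewrite scalerA scalerDl mulrAC mulrC.
Qed.

Definition positive_tangents (p : 'rV[R]_n) : set 'rV[R]_n :=
  [set x | exists2 d, 0 < d & forall i, 0 < (p + d *: x) 0 i].

Lemma positive_tangents_small (p x : 'rV[R]_n) : (forall i, 0 <= p 0 i) ->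
  positive_tangents p x ->
  exists2 d, 0 < d & forall s, 0 < s -> s <= d ->
    forall i, 0 < (p + s *: x) 0 i.
Proof.
move=> p0 [d d0 dP]; exists d => // s s0 sd i.
have := dP i; have := p0 i; rewrite !mxE => pi xi.
have sxi : 0 < s * (p 0 i + d * x 0 i) by rewrite mulr_gt0.
suff : 0 < d * (p 0 i + s * x 0 i) by rewrite pmulr_rgt0.
by nra.
Qed.

Lemma relopen_positive_tangents (p : 'rV[R]_n) : (forall i, 0 <= p 0 i) ->
  relopen fullv (positive_tangents p).
Proof.
move=> p0; split.
- exists (const_mx 1), 1 => // i; rewrite !mxE; have := p0 i; lra.
- by move=> x y _ _; apply: memvf.
- move=> x y s /(positive_tangents_small p0)[d d0 dP].
  move=> /(positive_tangents_small p0)[e e0 eP] s0 s1.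
  exists (Num.min d e); first by rewrite lt_min d0.
  set m := Num.min d e; have m0 : 0 < m by rewrite lt_min d0.
  move=> i; have := dP m m0; rewrite ge_min lexx => /(_ isT i).
  have := eP m m0; rewrite ge_min lexx orbT => /(_ isT i).
  rewrite !mxE; set b := _ + m * y 0 i; set a := _ + m * x 0 i => b0 a0.
  have -> : p 0 i + m * (x 0 i + s * (y 0 i - x 0 i)) = a + s * (b - a).
    by rewrite /a /b; ring.
  by nra.
- move=> x w [d d0 dP] _.
  have [|m m0 mP] := @uniform_small R _ (index_enum 'I_n)
      (fun i s => forall r, - s <= r -> r <= s ->
         0 < (p + d *: x) 0 i + r * (d * w 0 i)).
    by move=> i _; apply: small_perturbation.
  exists m => // s s1 s2; exists d => // i.
  have := mP m m0 (lexx _) i (mem_index_enum _) s s1 s2.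
  rewrite !mxE; congr (_ < _); ring.
Qed.

End Cones.

(** * Finite complexes and their generating polynomials *)

Lemma verticesP (V : choiceType) (K : {fset {fset V}}) v :
  reflect (exists2 sigma, sigma \in K & v \in sigma) (v \in vertices K).
Proof.
rewrite /vertices; apply: (iffP (bigfcupP _ _ _ _)).
  by case=> sigma /andP[sK _] vs; exists sigma.
by case=> sigma sK vs; exists sigma => //; rewrite sK.
Qed.

Lemma face_vertices (V : choiceType) (K : {fset {fset V}}) sigma :
  sigma \in K -> sigma `<=` vertices K.
Proof. by move=> sK; apply/fsubsetP => v vs; apply/verticesP; exists sigma. Qed.

Lemma linkP (V : choiceType) (K : {fset {fset V}}) sigma tau :
  reflect [/\ tau \in K, [disjoint sigma & tau] & sigma `|` tau \in K]
    (tau \in link K sigma).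
Proof.
by rewrite !inE /fdisjoint; apply: (iffP and3P).
Qed.

Lemma subset_of_card (V : choiceType) (sigma : {fset V}) m :
  (m <= #|` sigma|)%N -> exists2 tau, tau `<=` sigma & #|` tau| = m.
Proof.
move=> ms; exists [fset x in take m sigma].
  by apply/fsubsetP => x; rewrite !inE => /mem_take.
by rewrite card_fseq undup_id ?take_uniq ?fset_uniq // size_takel.
Qed.

Lemma prod_add1 (V : choiceType) (A : comNzRingType) (f : V -> A)
    (sigma : {fset V}) :
  \prod_(w <- sigma) (1 + f w) =
  \sum_(tau <- fpowerset sigma) \prod_(w <- tau) f w.
Proof.
elim/fset1U_rect: sigma => [|x sigma xN IH].
  by rewrite fpowerset0 big_seq_fset1 !big_seq_fset0.
rewrite big_fsetU1 //= mulrDl mul1r IH mulr_sumr.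
have perm_pow : perm_eq (fpowerset (x |` sigma))
    (enum_fset (fpowerset sigma) ++ [seq x |` tau | tau <- fpowerset sigma]).
  have sN tau : tau `<=` sigma -> x \notin tau.
    by move=> ts; apply: contra xN; apply: (fsubsetP ts).
  apply: uniq_perm; first exact: fset_uniq.
    rewrite cat_uniq fset_uniq map_inj_in_uniq ?fset_uniq ?andbT /=.
      apply/hasPn => _ /mapP[tau _ ->]; rewrite fpowersetE; apply/negP.
      by move=> /fsubsetP/(_ x); rewrite fset1U1 (negPf xN) => /(_ isT).
    move=> s t; rewrite !fpowersetE => /sN xs /sN xt /(congr1 (fun r => r `\ x)).
    by rewrite !fsetU1K.
  move=> tau; rewrite mem_cat !fpowersetE; apply/idP/orP => [ts|[ts|/mapP[rho]]].
  - case: (boolP (x \in tau)) => xt; last first.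
      left; apply/fsubsetP => w wt; have := fsubsetP ts w wt.
      by rewrite in_fset1U => /orP[/eqP wx|//]; rewrite -wx wt in xt.
    right; apply/mapP; exists (tau `\ x); last by rewrite fsetD1K.
    by rewrite fpowersetE fsubDset.
  - exact: fsubset_trans ts (fsubsetUr _ _).
  - by rewrite fpowersetE => rs ->; apply: fsetUS.
rewrite (perm_big _ perm_pow) big_cat big_map /=; congr (_ + _).
rewrite big_seq [RHS]big_seq; apply: eq_bigr => tau; rewrite fpowersetE => ts.
by rewrite big_fsetU1 //=; apply: contra xN; apply: (fsubsetP ts).
Qed.

Lemma magic_poly_rmorph (R : realType) (k : nat) (L : {fset {fset 'rV[R]_k.+1}})
    (A A' : comNzRingType) (f : {rmorphism A -> A'}) (u v : A) :
  f (magic_poly L u v) = magic_poly L (f u) (f v).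
Proof.
rewrite /magic_poly rmorphB rmorphXn rmorph_sum; congr (_ - _).
by apply: eq_bigr => s _; rewrite rmorphM !rmorphXn.
Qed.

Lemma add1_half_inv (F : fieldType) (t : F) : t != 0 -> (2 : F) != 0 ->
  1 + (t^-1 - 1) / 2 = (1 + t) / (2 * t).
Proof. by move=> t0 two0; field; apply/andP. Qed.

Lemma add1_half (F : fieldType) (x : F) : (2 : F) != 0 ->
  1 + (x - 1) / 2 = (1 + x) / 2.
Proof. by move=> two0; field. Qed.

Lemma mulN2N1_half (F : fieldType) (t : F) : (2 : F) != 0 ->
  - 2 * t * -1 / 2 = t.
Proof. by move=> two0; field. Qed.

Lemma expr_inv_sub (F : fieldType) (t : F) (m i : nat) : t != 0 ->
  (i <= m)%N -> t ^+ m * t^-1 ^+ (m - i) = t ^+ i.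
Proof.
move=> t0 im; rewrite -[in t ^+ m](subnKC im) exprD exprVn -mulrA mulfV ?mulr1 //.
by rewrite expf_neq0.
Qed.

Lemma tofrac_half (F : numFieldType) :
  tofrac ((2^-1 : F)%:P)%:P = 2^-1 :> {fraction {poly {poly F}}}.
Proof.
pose f : {rmorphism F -> {fraction {poly {poly F}}}} :=
  (@tofrac {poly {poly F}} \o (@polyC {poly F} \o @polyC F))%FUN.
by rewrite -[LHS]/(f 2^-1) fmorphV rmorph_nat.
Qed.

(** The argument of the f-polynomial in the definition of the F-polynomial. *)
Definition half_shift (R : realType) : {poly R} := 2^-1 *: ('X - 1).

Lemma Fpoly_sum (R : realType) (V : choiceType) (K : {fset {fset V}}) :
  Fpoly R K = \sum_(rho <- K) half_shift R ^+ #|` rho|.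
Proof.
rewrite /Fpoly -/(half_shift R); set N := (\max_(sigma <- K) _)%N.
transitivity (\sum_(0 <= j < N.+1) \sum_(rho <- K | j == #|` rho|)
    half_shift R ^+ #|` rho|).
  apply: eq_bigr => j _; rewrite scaler_nat /faces_card.
  under eq_bigl => rho do rewrite eq_sym.
  rewrite big_fset_condE (eq_big_seq (fun=> half_shift R ^+ j)).
    by rewrite big_const_seq count_predT iter_addr_0.
  by move=> rho; rewrite !inE => /andP[_ /eqP ->].
rewrite (exchange_big_dep predT) //=.
apply: (@eq_big_seq {poly R} 0 +%R {fset V}) => rho rK.
rewrite big_nat1_eq ltnS /N.
by rewrite (@leq_bigmax_seq _ _ predT (fun sigma : {fset V} => #|` sigma|)).
Qed.

(** * The interior faces around a face of the triangulation *)

Section Triangulation.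
Variables (R : realType) (k : nat) (L : {fset {fset 'rV[R]_k.+1}}).
Hypothesis k_gt0 : (0 < k)%N.
Hypothesis L_triangulation : simplex_triangulation L.
Hypothesis L_boundary : forall v, v \in vertices L -> simplex_boundary v ->
  exists i : 'I_k.+1, v = delta_mx 0 i.
Hypothesis L_interior : exists2 v, v \in vertices L & simplex_interior v.
Implicit Types (sigma tau : {fset 'rV[R]_k.+1}) (x v : 'rV[R]_k.+1).

Lemma L_complex : simplicial_complex L. Proof. by case: L_triangulation. Qed.

Lemma L_down sigma tau : sigma \in L -> tau `<=` sigma -> tau \in L.
Proof. exact: L_complex.2. Qed.

Lemma hull_std sigma x : sigma \in L -> convex_hull sigma x -> std_simplex x.
Proof.
case: L_triangulation => _ _ _ cover sL xs.
have : (\bigcup_(rho in [set` L]) convex_hull rho)%classic x by exists sigma.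
by rewrite cover.
Qed.

Lemma hull_vertex sigma v : v \in sigma -> convex_hull sigma v.
Proof.
move=> vs; exists (fun w => (w == v)%:R); split.
- by move=> w _; rewrite ler0n.
- rewrite (big_fsetD1 v) //= eqxx big1_fset ?addr0 // => w.
  by rewrite !inE => /andP[/negPf->].
- rewrite (big_fsetD1 v) //= eqxx scale1r big1_fset ?addr0 // => w.
  by rewrite !inE => /andP[/negPf->]; rewrite scale0r.
Qed.

Lemma vertex_std sigma v : sigma \in L -> v \in sigma -> std_simplex v.
Proof. by move=> sL /hull_vertex; apply: hull_std. Qed.

Lemma sum_coords_comb sigma (c : 'rV[R]_k.+1 -> R) : sigma \in L ->
  \sum_i (\sum_(v <- sigma) c v *: v) 0 i = \sum_(v <- sigma) c v.
Proof.
move=> sL; under eq_bigr => i _ do rewrite summxE.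
rewrite exchange_big; apply: eq_big_seq => v vs.
under eq_bigr => i _ do rewrite mxE.
by rewrite -mulr_sumr (vertex_std sL vs).2 mulr1.
Qed.

(** The vertices of a face lie on the hyperplane where the coordinates sum to
    [1], which misses the origin; there, affine and linear independence agree. *)
Lemma face_lin_indep sigma : sigma \in L -> lin_indep sigma.
Proof.
case: L_triangulation => _ aff _ _ sL c c0; apply: (aff sigma) => //.
by rewrite -(sum_coords_comb _ sL) c0 big1 // => i _; rewrite mxE.
Qed.

(** Scaled to the simplex, a common point lies in the hull of [sigma `&` tau];
    its coordinates on [sigma] are unique and positive, hence [sigma] is
    contained in [tau]. *)
Lemma open_cone_sub sigma tau x : sigma \in L -> tau \in L ->
  open_cone sigma x -> open_cone tau x -> sigma `<=` tau.
Proof.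
move=> sL tL [c c0 xc] [d d0 xd].
have sumE : \sum_(v <- sigma) c v = \sum_(v <- tau) d v.
  by rewrite -(sum_coords_comb _ sL) -xc xd (sum_coords_comb _ tL).
apply/fsubsetP => v vs; set s := \sum_(v <- sigma) c v in sumE.
have s0 : 0 < s.
  rewrite /s (big_fsetD1 v) //= ltr_pwDl ?c0 // big_seq.
  by apply: sumr_ge0 => w; rewrite !inE => /andP[_ /c0/ltW].
have scaled_hull (rho : {fset 'rV[R]_k.+1}) (e : _ -> R) :
    (forall v, v \in rho -> 0 < e v) ->
    \sum_(v <- rho) e v = s -> x = \sum_(v <- rho) e v *: v ->
    convex_hull rho (s^-1 *: x).
  move=> e0 es ->; exists (fun v => s^-1 * e v); split.
  - move=> w wr; apply: mulr_ge0; last exact/ltW/e0.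
    by rewrite invr_ge0 ltW.
  - by rewrite -mulr_sumr es mulVf // gt_eqF.
  - by rewrite scaler_sumr; apply: eq_bigr => w _; rewrite scalerA.
have : (convex_hull sigma `&` convex_hull tau)%classic (s^-1 *: x).
  by split; [apply: (scaled_hull _ c) | apply: (scaled_hull _ d)].
case: L_triangulation => _ _ -> // _ [g [_ _ xg]].
rewrite (sum_sub_face _ (fsubsetIl sigma tau)) xc scaler_sumr in xg.
have {}xg : \sum_(w <- sigma) (s^-1 * c w) *: w =
    \sum_(w <- sigma) (if w \in sigma `&` tau then g w else 0) *: w.
  by rewrite -xg; apply: eq_bigr => w _; rewrite scalerA.
have := lin_indep_eq (face_lin_indep sL) xg vs.
rewrite inE vs /=; case: (v \in tau) => // /eqP.
by rewrite mulf_eq0 invr_eq0 !gt_eqF ?c0.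
Qed.

Lemma open_cone_inj sigma tau x : sigma \in L -> tau \in L ->
  open_cone sigma x -> open_cone tau x -> sigma = tau.
Proof.
move=> sL tL xs xt; apply/eqP; rewrite eqEfsubset.
by rewrite (open_cone_sub sL tL xs xt) (open_cone_sub tL sL xt xs).
Qed.

Lemma open_cone_cover x : (forall i, 0 <= x 0 i) ->
  exists2 sigma, sigma \in L & open_cone sigma x.
Proof.
move=> x0; have [sx|sx] := eqVneq (\sum_i x 0 i) 0.
  exists fset0; first exact: L_complex.1.
  exists (fun=> 1) => //; rewrite big_seq_fset0.
  apply/rowP => i; rewrite mxE.
  by move/eqP: sx; rewrite psumr_eq0 // => /allP/(_ i (mem_index_enum _))/eqP.
set s := \sum_i x 0 i in sx.
have s0 : 0 < s by rewrite lt_def sx sumr_ge0.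
have : std_simplex (s^-1 *: x).
  split=> [i|]; first by rewrite mxE mulr_ge0 ?invr_ge0 // ltW.
  by under eq_bigr => i _ do rewrite mxE; rewrite -mulr_sumr mulVf.
case: L_triangulation => _ _ _ cover; rewrite -cover => -[sigma sL [c [c0 _ xc]]].
pose tau := [fset v in sigma | c v != 0].
have ts : tau `<=` sigma by apply/fsubsetP => v; rewrite !inE => /andP[].
exists tau; first exact: L_down ts.
exists (fun v => s * c v).
  by move=> v; rewrite !inE => /andP[/c0 cv cn]; rewrite mulr_gt0 // lt_def cn.
rewrite -[x](scale1r x) -(mulfV sx) -scalerA xc scaler_sumr.
rewrite (sum_sub_face _ ts); apply: eq_big_seq => v vs.
by rewrite !inE vs /=; case: eqP => [->|_]; rewrite ?scale0r ?scaler0 // scalerA.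
Qed.

Lemma boundary_complexP sigma : sigma \in L ->
  reflect (exists i, forall v, v \in sigma -> v 0 i = 0)
          (sigma \in boundary_complex L).
Proof.
move=> sL; rewrite !inE sL /=; apply: (iffP (asboolP _)) => [bd|[i i0] x xs].
  have [/= s0|/fset0Pn[v0 v0s]] := eqVneq sigma fset0.
    by exists 0 => v; rewrite s0.
  pose N : R := (#|` sigma|)%:R.
  have N0 : 0 < N by rewrite ltr0n cardfs_gt0; apply/fset0Pn; exists v0.
  have : convex_hull sigma (\sum_(v <- sigma) N^-1 *: v).
    exists (fun=> N^-1); split=> //; first by move=> _ _; rewrite invr_ge0 ltW.
    by rewrite big_const_seq count_predT iter_addr_0 -mulr_natl mulfV // gt_eqF.
  move=> /bd[_ [i /eqP]]; rewrite summxE big_seq psumr_eq0; last first.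
    move=> v vs; rewrite mxE; apply: mulr_ge0; last exact: (vertex_std sL vs).1.
    by rewrite invr_ge0 ltW.
  move=> /allP i0; exists i => v vs; move: (i0 v vs).
  by rewrite vs mxE mulf_eq0 invr_eq0 gt_eqF //= => /eqP.
split; first exact: (hull_std sL).
case: xs => c [_ _ ->]; exists i; rewrite summxE big1_seq // => v /andP[_ vs].
by rewrite mxE i0 // mulr0.
Qed.

(** By nonnegativity of the vertices a coordinate of [x] vanishes exactly when
    it vanishes at all vertices of [sigma]. *)
Lemma open_cone_interior sigma x : sigma \in L -> open_cone sigma x ->
  (sigma \notin boundary_complex L) <-> (forall i, 0 < x 0 i).
Proof.
move=> sL [c c0 ->].
have nn v : v \in sigma -> forall i, 0 <= v 0 i.
  by move=> vs; apply: (vertex_std sL vs).1.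
split=> [/boundary_complexP nbd i|pos]; last first.
  apply/boundary_complexP => // -[i i0]; have := pos i.
  rewrite summxE big1_seq ?ltxx // => v /andP[_ vs].
  by rewrite mxE i0 // mulr0.
have [v vs vi] : exists2 v, v \in sigma & v 0 i != 0.
  apply: contrapT => H; apply: nbd => //; exists i => v vs.
  by apply/eqP; apply: contrapT => /negP vi; apply: H; exists v.
rewrite summxE (big_fsetD1 v) //= mxE ltr_pwDl //.
  by rewrite mulr_gt0 ?c0 // lt_def vi nn.
rewrite big_seq sumr_ge0 // => w; rewrite !inE => /andP[_ ws].
by rewrite mxE; apply: mulr_ge0; [apply/ltW/c0 | apply: nn].
Qed.

(** A limit argument: if the open cone of [sigma] contains points [p + s *: x]
    with [s] arbitrarily small, then the coordinates of [p] on [sigma] are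
    nonnegative, so that [p] lies in the open cone of a face of [sigma]; but
    [p], the sum of the vertices of [tau], lies in the open cone of [tau]. *)
Lemma near_carrier sigma tau x : sigma \in L -> tau \in L ->
  exists2 d, 0 < d & forall s, 0 < s -> s <= d ->
    open_cone sigma (\sum_(v <- tau) v + s *: x) -> tau `<=` sigma.
Proof.
move=> sL tL; set p := \sum_(v <- tau) v.
case: (pselect (forall d, 0 < d -> exists s, [/\ 0 < s, s <= d &
         open_cone sigma (p + s *: x)])) => [close|far]; last first.
  apply: contrapT => H; apply: far => d d0; apply: contrapT => H'.
  by apply: H; exists d => // s s0 sd xs; case: H'; exists s.
exists 1 => // _ _ _ _.
(* Two points of the line suffice to put both p and x in the span of sigma, with
   coordinates g and h. *)
have [s1 [s10 _ [a a0 aE]]] := close 1 ltr01.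
have [|s2 [s20 s21 [b b0 bE]]] := close (s1 / 2); first by lra.
have s12 : s1 - s2 != 0 by rewrite gt_eqF //; lra.
pose g v := (s1 * b v - s2 * a v) / (s1 - s2).
pose h v := (a v - b v) / (s1 - s2).
have combE (e1 e2 : R) :
    \sum_(v <- sigma) ((e1 * a v + e2 * b v) / (s1 - s2)) *: v
    = (s1 - s2)^-1 *: (e1 *: (p + s1 *: x) + e2 *: (p + s2 *: x)).
  rewrite aE bE !scaler_sumr -big_split scaler_sumr /=.
  by apply: eq_bigr => v _; rewrite !scalerA -scalerDl scalerA mulrC.
have pE : p = \sum_(v <- sigma) g v *: v.
  rewrite (eq_bigr (fun v => ((- s2 * a v + s1 * b v) / (s1 - s2)) *: v)).
    by rewrite combE; apply/rowP => i; rewrite !mxE; field.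
  by move=> v _; congr (_ *: _); rewrite /g addrC mulNr.
have xE : x = \sum_(v <- sigma) h v *: v.
  rewrite (eq_bigr (fun v => ((1 * a v + (-1) * b v) / (s1 - s2)) *: v)).
    by rewrite combE; apply/rowP => i; rewrite !mxE; field.
  by move=> v _; congr (_ *: _); rewrite /h mul1r mulN1r.
have g0 v : v \in sigma -> 0 <= g v.
  move=> vs; rewrite leNgt; apply/negP => gv.
  have [|d d0 dP] := @small_perturbation R (- g v) (- h v); first by lra.
  have [s [s0 sd [c c0 cE]]] := close d d0.
  have : \sum_(v <- sigma) (g v + s * h v) *: v = \sum_(v <- sigma) c v *: v.
    rewrite -cE pE xE scaler_sumr -big_split; apply: eq_bigr => w _ /=.
    by rewrite scalerDl scalerA.
  move=> /(lin_indep_eq (face_lin_indep sL))/(_ _ vs) gc.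
  have := c0 v vs; rewrite -gc.
  have := dP d d0 (lexx _) s _ sd; rewrite mulrN; lra.
pose rho := [fset v in sigma | g v != 0].
have rs : rho `<=` sigma by apply/fsubsetP => v; rewrite !inE => /andP[].
suff -> : tau = rho by [].
apply: (@open_cone_inj _ _ p) => //; first exact: L_down rs.
  by exists (fun=> 1) => //; apply: eq_bigr => v _; rewrite scale1r.
exists g.
  by move=> v; rewrite !inE => /andP[/g0 ? ?]; rewrite lt_def; apply/andP.
rewrite (sum_sub_face _ rs) [LHS]pE; apply: eq_big_seq => v vs.
by rewrite !inE vs /=; case: eqP => // ->.
Qed.

Definition interior_faces := L `\` boundary_complex L.

Lemma interior_faceP sigma :
  (sigma \in interior_faces) = (sigma \in L) && (sigma \notin boundary_complex L).
Proof. by rewrite in_fsetD andbC. Qed.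

(** For small [d] the point [p + d *: x] has positive coordinates, and the one
    face whose open cone contains it is interior and contains [tau]. *)
Lemma tangent_cones_partition (A : nzRingType) tau x : tau \in L ->
  \sum_(sigma <- interior_faces | tau `<=` sigma)
      ind A (tangent_cone sigma (\sum_(v <- tau) v) x)
    = ind A (positive_tangents (\sum_(v <- tau) v) x).
Proof.
move=> tL; set p := \sum_(v <- tau) v.
have p0 i : 0 <= p 0 i.
  rewrite summxE big_seq sumr_ge0 // => v vt; exact: (vertex_std tL vt).1.
case: (pselect (positive_tangents p x)) => [pos|npos]; last first.
  rewrite (indF _ npos) big_seq_cond big1 // => sigma /andP[].
  rewrite interior_faceP => /andP[sL sI] ts; rewrite indF // => -[d d0 xs].
  by apply: npos; exists d => //; apply/(open_cone_interior sL xs).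
rewrite (indT _ pos).
have [d d0 dP] := positive_tangents_small p0 pos.
have [e e0 eP] := uniform_small (fun sigma sL => near_carrier x sL tL).
pose m := Num.min d e; have m0 : 0 < m by rewrite lt_min d0.
have md : m <= d by rewrite ge_min lexx.
have me : m <= e by rewrite ge_min lexx orbT.
have [i|sigma sL xs] := @open_cone_cover (p + m *: x).
  exact/ltW/dP.
have ts := eP m m0 me sigma sL xs.
have sI : sigma \in interior_faces.
  by rewrite interior_faceP sL; apply/(open_cone_interior sL xs); apply: dP.
rewrite (big_rem sigma) //= ts indT; last by exists m.
rewrite big_seq_cond big1 ?addr0 // => rho /andP[].
rewrite (rem_filter _ (fset_uniq _)) mem_filter /= interior_faceP.
move=> /and3P[rs rL _] tr; rewrite indF // => xr.
have [f f0 fP] := tangent_cone_small tr xr.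
have xs' : tangent_cone sigma p x by exists m.
have [g g0 gP] := tangent_cone_small ts xs'.
pose q := Num.min f g; have q0 : 0 < q by rewrite lt_min f0.
case/eqP: rs; apply: (@open_cone_inj _ _ (p + q *: x)) => //.
  by apply: fP; rewrite // ge_min lexx.
by apply: gP; rewrite // ge_min lexx orbT.
Qed.

(** The link of an interior face is a sphere and that of a boundary face is a
    ball; counting only interior faces gives the same sign in both cases, also
    for [tau = fset0].  In the proof the Euler relation is applied to the
    partition of an open convex cone into tangent cones. *)
Lemma interior_star_euler (A : nzRingType) tau : tau \in L ->
  \sum_(sigma <- interior_faces | tau `<=` sigma) (-1) ^+ #|` sigma|
    = (-1) ^+ k.+1 :> A.
Proof.
move=> tL; set p := \sum_(v <- tau) v.
have p0 i : 0 <= p 0 i.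
  rewrite summxE big_seq sumr_ge0 // => v vt; exact: (vertex_std tL vt).1.
(* None stands for the open cone that the tangent cones partition. *)
pose r : seq (option {fset 'rV[R]_k.+1}) :=
  None :: [seq Some sigma | sigma <- interior_faces & tau `<=` sigma].
pose a (i : option {fset 'rV[R]_k.+1}) : A := if i is None then -1 else 1.
pose W (i : option {fset 'rV[R]_k.+1}) :=
  if i is Some sigma then <<sigma>>%VS else fullv.
pose P (i : option {fset 'rV[R]_k.+1}) :=
  if i is Some sigma then tangent_cone sigma p else positive_tangents p.
have Popen i : i \in r -> relopen (W i) (P i).
  move: i => [sigma|] /=; last by move=> _; apply: relopen_positive_tangents.
  rewrite inE /= => /mapP[rho]; rewrite mem_filter interior_faceP.
  move=> /and3P[ts sL _] [->]; apply: relopen_tangent_cone => //.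
  exact: face_lin_indep.
have Psum x : \sum_(i <- r) a i * ind A (P i x) = 0.
  rewrite big_cons big_map big_filter /= -(tangent_cones_partition _ _ tL).
  rewrite mulN1r; under [X in _ + X]eq_bigr => i _ do rewrite mul1r.
  by rewrite addNr.
have := euler_relation Popen Psum.
rewrite big_cons big_map big_filter /= mulN1r => /eqP.
rewrite addrC subr_eq0 => /eqP; rewrite dimvf /dim /= mul1n => <-.
rewrite big_seq_cond [RHS]big_seq_cond; apply: eq_bigr => sigma /andP[].
rewrite interior_faceP => /andP[sL _] _.
by rewrite mul1r (eqnP (lin_indep_free (face_lin_indep sL))).
Qed.

(** * The boundary complex and the symmetry of the magic polynomial *)

Definition corners : {fset 'rV[R]_k.+1} :=
  [fset delta_mx 0 i | i : 'I_k.+1].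

Lemma cornersP v : reflect (exists i, v = delta_mx 0 i) (v \in corners).
Proof.
apply: (iffP (imfsetP _ _ _ _)) => [[i _ ->]|[i ->]]; first by exists i.
by exists i.
Qed.

Lemma delta_inj (i j : 'I_k.+1) :
  delta_mx 0 i = delta_mx 0 j :> 'rV[R]_k.+1 -> i = j.
Proof.
move=> /rowP/(_ i); rewrite !mxE !eqxx /=.
by case: (eqVneq i j) => //= _ /eqP; rewrite oner_eq0.
Qed.

Lemma card_corners : #|` corners| = k.+1.
Proof.
rewrite card_imfset /=; last exact: delta_inj.
by rewrite -cardE card_ord.
Qed.

Lemma boundary_vertex v i : v \in vertices L -> v 0 i = 0 -> v \in corners.
Proof.
case/verticesP => sigma sL vs vi; apply/cornersP; apply: L_boundary.
  by apply/verticesP; exists sigma.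
by split; [exact: (vertex_std sL vs) | exists i].
Qed.

(** The vertices of the carrier of the sum of [sigma] vanish at a coordinate
    where all of [sigma] does, so they are corners, and the carrier contains
    [sigma]. *)
Lemma proper_corner_face sigma : sigma `<=` corners -> sigma != corners ->
  sigma \in L.
Proof.
move=> sE sN.
have [i iN] : exists i, delta_mx 0 i \notin sigma.
  apply: contrapT => H; case/eqP: sN; apply/eqP; rewrite eqEfsubset sE /=.
  apply/fsubsetP => v /cornersP[i ->]; apply: contrapT => /negP iN.
  by apply: H; exists i.
pose x := \sum_(v <- sigma) v.
have x0 j : 0 <= x 0 j.
  rewrite summxE big_seq sumr_ge0 // => v /(fsubsetP sE)/cornersP[l ->].
  by rewrite mxE ler0n.
have xi : x 0 i = 0.
  rewrite summxE big1_seq // => v /andP[_ vs].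
  have /cornersP[l vE] := fsubsetP sE v vs.
  rewrite vE mxE eqxx /=; case: eqVneq => // il.
  by rewrite il -vE vs in iN.
have [tau tL [c c0 xc]] := open_cone_cover x0.
have t0 v : v \in tau -> forall j, 0 <= v 0 j.
  by move=> vt; exact: (vertex_std tL vt).1.
have tE v : v \in tau -> v \in corners.
  move=> vt; apply: (@boundary_vertex v i).
    by apply/verticesP; exists tau.
  have /eqP := xi; rewrite xc summxE big_seq psumr_eq0; last first.
    by move=> w wt; rewrite mxE; apply: mulr_ge0; [apply/ltW/c0 | apply: t0].
  move=> /allP/(_ v vt); rewrite vt /= mxE mulf_eq0 => /orP[|/eqP//].
  by rewrite gt_eqF ?c0.
apply: (L_down tL); apply/fsubsetP => v vs.
have /cornersP[l vE] := fsubsetP sE v vs.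
apply: contrapT => /negP vt.
have : x 0 l = 0.
  rewrite xc summxE big1_seq // => w /andP[_ wt].
  have /cornersP[m wE] := tE w wt.
  rewrite mxE wE mxE eqxx /=; case: eqVneq => [lm|]; rewrite ?mulr0 //.
  by rewrite vE lm -wE wt in vt.
apply/eqP; rewrite /x summxE (big_fsetD1 v) //= gt_eqF // ltr_pwDl //.
  by rewrite vE mxE !eqxx ltr01.
rewrite big_seq sumr_ge0 // => w; rewrite !inE => /andP[_ /(fsubsetP sE)].
by case/cornersP => m ->; rewrite mxE ler0n.
Qed.

(** If the whole simplex were a face, its open cone would meet the one of an
    interior vertex. *)
Lemma corners_notin : corners \notin L.
Proof.
apply/negP => EL; case: L_interior => v /verticesP[sigma sL vs] [_ v0].
have vL : [fset v] \in L.
  by apply: (L_down sL); rewrite fsub1set.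
have : [fset v] = corners.
  apply: (@open_cone_inj _ _ v) => //.
    by exists (fun=> 1) => //; rewrite big_seq_fset1 scale1r.
  exists (fun w => \sum_i v 0 i * (w == delta_mx 0 i)%:R).
    move=> w /cornersP[i ->]; rewrite (bigD1 i) //= eqxx mulr1 ltr_pwDl //.
    by rewrite sumr_ge0 // => j _; rewrite mulr_ge0 ?ler0n // ltW.
  rewrite big_imfset /=; last by move=> i j _ _; apply: delta_inj.
  rewrite big_enum /= [LHS]row_sum_delta; apply: eq_bigr => i _.
  rewrite (bigD1 i) //= eqxx mulr1 big1 ?addr0 // => j ji.
  by rewrite (inj_eq delta_inj) eq_sym (negPf ji) mulr0.
move/(congr1 (fun s : {fset _} => #|` s|)); rewrite cardfs1 card_corners.
by case; move: k_gt0; case: (k).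
Qed.

Lemma boundary_complexE sigma :
  (sigma \in boundary_complex L) = (sigma `<=` corners) && (sigma != corners).
Proof.
apply/idP/andP => [sB|[sE sN]].
  have sL : sigma \in L by move: sB; rewrite !inE => /andP[].
  split; last by apply: contraNneq corners_notin => <-.
  have /boundary_complexP := sB; case/(_ sL) => i si.
  apply/fsubsetP => v vs; apply: (@boundary_vertex v i); last exact: si.
  by apply/verticesP; exists sigma.
have sL := proper_corner_face sE sN.
apply/(boundary_complexP sL).
have /fsubsetPn[v /cornersP[i ->] iN] : ~~ (corners `<=` sigma).
  by apply: contra sN => Es; rewrite eqEfsubset sE.
exists i => w ws; have /cornersP[j wE] := fsubsetP sE w ws.
rewrite wE mxE eqxx /=; case: eqVneq => // ij.
by rewrite ij -wE ws in iN.
Qed.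

Lemma vertices_boundary : vertices (boundary_complex L) = corners.
Proof.
apply/fsetP => v; apply/verticesP/idP => [[sigma]|vE].
  by rewrite boundary_complexE => /andP[/fsubsetP sE _] /sE.
exists [fset v]; last by rewrite inE.
rewrite boundary_complexE fsub1set vE /=; apply/eqP.
move/(congr1 (fun s : {fset _} => #|` s|)); rewrite cardfs1 card_corners.
by case; move: k_gt0; case: (k).
Qed.

Lemma interior_verticesE : interior_vertices L = vertices L `\` corners.
Proof.
apply/fsetP => v; rewrite !inE andbC.
case: (boolP (v \in vertices L)) => [vL|]; last by rewrite !andbF.
rewrite !andbT; apply/asboolP/idP => [[_ v0]|vN].
  apply/negP => /cornersP[i vE].
  have [j ji] : exists j : 'I_k.+1, j != i.
    case: (eqVneq i ord0) => [->|].
      by exists ord_max; rewrite -val_eqE /= -lt0n.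
    by rewrite eq_sym; exists ord0.
  by have := v0 j; rewrite vE mxE eqxx (negPf ji) ltxx.
have /verticesP[sigma sL vs] := vL.
have sv := vertex_std sL vs; split=> // i.
rewrite lt_def sv.1 andbT; apply: contra vN => /eqP.
exact: boundary_vertex.
Qed.

Lemma interior_facesE sigma :
  (sigma \in interior_faces) = (sigma \in L) && ~~ (sigma `<=` corners).
Proof.
rewrite interior_faceP boundary_complexE; case: (boolP (sigma \in L)) => //= sL.
rewrite negb_and negbK orb_idr // => /eqP sE.
by have := corners_notin; rewrite -sE sL.
Qed.

Section Weight.
Variable (A : comNzRingType).

Definition weight (u v : A) sigma : A :=
  u ^+ #|` sigma `&` corners| * v ^+ #|` sigma `\` corners|.

Lemma magic_polyE (u v : A) : magic_poly L u v =
  \sum_(sigma <- interior_faces) weight u v sigma - u ^+ k.+1.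
Proof.
rewrite /magic_poly vertices_boundary interior_verticesE; congr (_ - _).
rewrite big_seq [RHS]big_seq; apply: eq_bigr => sigma sI.
rewrite /weight; congr (_ * _ ^+ _); congr (#|` _|).
apply/fsetP => w; rewrite !inE.
case: (boolP (w \in sigma)) => [ws|_]; last by rewrite andbF.
rewrite andbT; have -> : w \in vertices L; last by rewrite andbT.
apply/verticesP; exists sigma => //.
by move: sI; rewrite interior_faceP => /andP[].
Qed.

(** As a product over vertices, a weight can be expanded and its signs pulled
    out vertex by vertex. *)
Lemma prod_weight (u v : A) sigma : weight u v sigma =
  \prod_(w <- sigma) (if w \in corners then u else v).
Proof.
have prod_const (S : {fset 'rV[R]_k.+1}) F (a : A) :
    (forall w, w \in S -> F w = a) -> \prod_(w <- S) F w = a ^+ #|` S|.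
  move=> Fa; rewrite (eq_big_seq (fun=> a)) //.
  by rewrite big_const_seq count_predT iter_mulr_1.
rewrite (big_fsetID _ (mem corners)) /weight /=; congr (_ * _).
  rewrite (prod_const _ _ u); last by move=> w; rewrite !inE => /andP[_ ->].
  by congr (_ ^+ #|` _|); apply/fsetP => w; rewrite !inE.
rewrite (prod_const _ _ v); last by move=> w; rewrite !inE => /andP[_ /negPf->].
by congr (_ ^+ #|` _|); apply/fsetP => w; rewrite !inE andbC.
Qed.

Lemma weight_add1 (u v : A) sigma :
  weight (1 + u) (1 + v) sigma = \sum_(tau <- fpowerset sigma) weight u v tau.
Proof.
under [RHS]eq_bigr => tau _ do rewrite prod_weight.
by rewrite -prod_add1 prod_weight; apply: eq_bigr => w _; case: ifP.
Qed.

Lemma weightN (u v : A) sigma :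
  weight (- u) (- v) sigma = (-1) ^+ #|` sigma| * weight u v sigma.
Proof.
rewrite !prod_weight.
rewrite (eq_bigr (fun w => -1 * (if w \in corners then u else v))).
  rewrite big_split /=; congr (_ * _).
  by rewrite big_const_seq count_predT iter_mulr_1.
by move=> w _; rewrite mulN1r; case: ifP.
Qed.

Lemma weight_corners (u v : A) : weight u v corners = u ^+ k.+1.
Proof. by rewrite /weight fsetIid fsetDv cardfs0 mulr1 card_corners. Qed.

Lemma sum_boundary (u v : A) :
  \sum_(sigma <- boundary_complex L) weight u v sigma
    = (1 + u) ^+ k.+1 - u ^+ k.+1.
Proof.
rewrite -(weight_corners (1 + u) (1 + v)) weight_add1 -(weight_corners u v).
have perm_pow : perm_eq (fpowerset corners)
    (corners :: enum_fset (boundary_complex L)).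
  apply: uniq_perm; first exact: fset_uniq.
    by rewrite /= fset_uniq andbT boundary_complexE eqxx andbF.
  move=> sigma; rewrite inE fpowersetE boundary_complexE.
  by case: eqVneq => [->|_]; rewrite ?fsubset_refl ?andbT.
by rewrite (perm_big _ perm_pow) big_cons [X in _ = X - _]addrC addrK.
Qed.

(** Expand the weights at [1 + u] and [1 + v] as sums over subsets and
    exchange the sums: each face [tau] of [L] receives the signed count of the
    interior faces around it.  The boundary faces contribute
    [(1 + u) ^+ k.+1 - u ^+ k.+1], which the terms [u ^+ k.+1] in the definition of the magic
    polynomial compensate. *)
Lemma magic_poly_symmetry (u v : A) :
  magic_poly L (- (1 + u)) (- (1 + v)) = (-1) ^+ k.+1 * magic_poly L u v.
Proof.
suff main : \sum_(sigma <- interior_faces)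
      weight (- (1 + u)) (- (1 + v)) sigma = (-1) ^+ k.+1 *
      (\sum_(sigma <- interior_faces) weight u v sigma
       + ((1 + u) ^+ k.+1 - u ^+ k.+1)).
  by rewrite !magic_polyE main [(- (1 + u)) ^+ _]exprNn; ring.
rewrite -(sum_boundary u v).
have perm_L : perm_eq L (enum_fset interior_faces ++ boundary_complex L).
  apply: uniq_perm; first exact: fset_uniq.
    rewrite cat_uniq !fset_uniq andbT /=; apply/hasPn => sigma sB.
    by rewrite interior_faceP /= sB andbF.
  move=> sigma; rewrite mem_cat interior_faceP.
  case: (boolP (sigma \in boundary_complex L)) => sB;
    rewrite ?orbT ?orbF ?andbT //.
  by move: sB; rewrite !inE => /andP[].
rewrite -big_cat -(perm_big _ perm_L) /= mulr_sumr.
under eq_bigr => sigma _ do rewrite weightN weight_add1 mulr_sumr.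
have subL sigma : sigma \in interior_faces ->
    \sum_(tau <- fpowerset sigma) (-1) ^+ #|` sigma| * weight u v tau =
    \sum_(tau <- L | tau `<=` sigma) (-1) ^+ #|` sigma| * weight u v tau.
  rewrite interior_faceP => /andP[sL _]; rewrite -[RHS]big_filter.
  apply: perm_big; apply: uniq_perm; rewrite ?filter_uniq ?fset_uniq //.
  move=> tau; rewrite mem_filter fpowersetE.
  by case: (boolP (tau `<=` sigma)) => // /(L_down sL) ->.
rewrite (eq_big_seq _ subL) (exchange_big_dep predT) //=.
apply: eq_big_seq => tau tL.
by rewrite -mulr_suml interior_star_euler.
Qed.

End Weight.

(** * A subdivision step *)

Lemma corners_vertices : corners `<=` vertices L.
Proof.
apply/fsubsetP => v vB; apply/verticesP; exists [fset v]; last by rewrite inE.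
apply: proper_corner_face; first by rewrite fsub1set.
apply/eqP => /(congr1 (fun s : {fset _} => #|` s|)).
by rewrite cardfs1 card_corners; case; move: k_gt0; case: (k).
Qed.

Section OneStep.
Variable V : choiceType.
Implicit Types rho : {fset V}.
Variables (K K' : {fset {fset V}}) (sigma : {fset V}).
Variable psi : 'rV[R]_k.+1 -> V.
Hypothesis K_complex : simplicial_complex K.
Hypothesis psi_inj : {in vertices L &, injective psi}.
Hypothesis psi_sigma : psi @` vertices (boundary_complex L) = sigma.
Hypothesis psi_new : forall w,
  w \in interior_vertices L -> psi w \notin vertices K.
Hypothesis K'E :
  K' = (K `\` [fset sigma `|` theta | theta in link K sigma])
             `|` [fset (psi @` sigma') `|` theta
                   | sigma' : {fset 'rV[R]_k.+1} in L,
                     theta : {fset V} in link K sigma].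

Lemma psi_corners : psi @` corners = sigma.
Proof. by rewrite -psi_sigma vertices_boundary. Qed.

Lemma psi_in_sigma w : w \in vertices L -> (psi w \in sigma) = (w \in corners).
Proof.
move=> wL; rewrite -psi_corners.
apply/imfsetP/idP => [[v /= vB]|wB]; last by exists w.
by move/psi_inj => -> //; apply: (fsubsetP corners_vertices).
Qed.

Lemma psi_notin w :
  w \in vertices L -> w \notin corners -> psi w \notin vertices K.
Proof.
move=> wL wB; apply: psi_new; rewrite interior_verticesE //.
by rewrite inE wB.
Qed.

Lemma card_sigma : #|` sigma| = k.+1.
Proof.
rewrite -psi_corners card_in_imfset /= ?card_corners // => v w vB wB.
by apply: psi_inj; apply: (fsubsetP corners_vertices).
Qed.

Lemma link_psi_disjoint (theta : {fset V}) w :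
  theta \in link K sigma -> w \in vertices L -> psi w \notin theta.
Proof.
case/linkP => tK dis _ wL; case: (boolP (w \in corners)) => wB.
  by apply: (fdisjointP dis); rewrite psi_in_sigma.
by apply: contra (psi_notin wL wB); apply: (fsubsetP (face_vertices tK)).
Qed.

Lemma star_link rho : rho \in K -> sigma `<=` rho ->
  rho `\` sigma \in link K sigma /\ sigma `|` rho `\` sigma = rho.
Proof.
move=> rK sr; have rE : sigma `|` rho `\` sigma = rho.
  apply/fsetP => x; rewrite !inE; case: (boolP (x \in sigma)) => //= xs.
  by rewrite (fsubsetP sr).
split=> //; apply/linkP; split; last by rewrite rE.
  by apply: K_complex.2 rK _; apply: fsubsetDl.
by apply/fdisjointP => x xs; rewrite inE xs.
Qed.

Lemma star_perm : perm_eq K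
  ([seq rho <- K | ~~ (sigma `<=` rho)] ++
   [seq sigma `|` theta | theta <- link K sigma]).
Proof.
apply: uniq_perm; first exact: fset_uniq.
  rewrite cat_uniq filter_uniq ?fset_uniq //= map_inj_in_uniq ?fset_uniq ?andbT.
    by apply/hasPn => _ /mapP[theta _ ->]; rewrite mem_filter fsubsetUl.
  have linkD t : t \in link K sigma -> (sigma `|` t) `\` sigma = t.
    case/linkP => _ /fdisjointP dis _; apply/fsetP => x; rewrite !inE.
    by case: (boolP (x \in sigma)) => //= /dis /negPf->.
  by move=> s t /linkD {2}<- /linkD {2}<- ->.
move=> rho; rewrite mem_cat mem_filter.
apply/idP/orP => [rK|[/andP[]//|/mapP[theta /linkP[_ _ stK] ->]//]].
case: (boolP (sigma `<=` rho)) => sr; [right | by left].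
have [lr rE] := star_link rK sr.
by apply/mapP; exists (rho `\` sigma).
Qed.

(** A proper boundary face of [L] only reproduces faces that are already in
    [K], so the genuinely new faces come from the interior faces of [L]. *)
Lemma step_memP rho : reflect
  ((rho \in K /\ ~~ (sigma `<=` rho)) \/
   exists s (theta : {fset V}),
     [/\ s \in interior_faces, theta \in link K sigma & rho = psi @` s `|` theta])
  (rho \in K').
Proof.
rewrite K'E in_fsetU in_fsetD; apply: (iffP orP).
  case=> [/andP[rN rK]|/imfset2P[s /= sL [theta /= tl ->]]].
    left; split=> //; apply: contra rN => sr; have [lr rE] := star_link rK sr.
    by apply/imfsetP; exists (rho `\` sigma).
  case: (boolP (s \in interior_faces)) => sI; first by right; exists s, theta.
  left; move: sI; rewrite interior_facesE // sL /= negbK => sB.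
  have ps : psi @` s `<=` sigma.
    apply/fsubsetP => _ /imfsetP[w /= ws ->]; rewrite psi_in_sigma.
      exact: (fsubsetP sB).
    exact: (fsubsetP (face_vertices sL)).
  case/linkP: tl => tK dis stK; split.
    by apply: K_complex.2 stK _; apply: fsetSU.
  apply/negP => sub.
  have : sigma `<=` psi @` s.
    apply/fsubsetP => x xs; have := fsubsetP sub x xs.
    by rewrite inE => /orP[//|xt]; have := fdisjointP dis x xs; rewrite xt.
  move=> /fsubset_leq_card; rewrite card_sigma leqNgt => /negP; apply.
  apply: leq_ltn_trans (leq_imfset_card _ _ _) _.
  suff /fproper_ltn_card : s `<` corners by rewrite card_corners.
  rewrite fproperEneq sB andbT; apply/eqP => sE.
  by have := corners_notin; rewrite -sE sL.
case=> [[rK sr]|[s [theta [sI tl ->]]]]; last first.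
  right; apply/imfset2P; exists s; last by exists theta.
  by move: sI; rewrite interior_faceP => /andP[].
left; rewrite rK andbT; apply: contra sr => /imfsetP[theta /= _ ->].
exact: fsubsetUl.
Qed.

Lemma psi_mem s (theta : {fset V}) w :
  s \in L -> theta \in link K sigma -> w \in vertices L ->
  (psi w \in psi @` s `|` theta) = (w \in s).
Proof.
move=> sL tl wL; rewrite in_fsetU (negPf (link_psi_disjoint tl wL)) orbF.
apply/imfsetP/idP => [[v /= vs]|ws]; last by exists w.
by move/psi_inj => -> //; apply: (fsubsetP (face_vertices sL)).
Qed.

Lemma interior_face_vertex s : s \in interior_faces ->
  exists w, [/\ w \in s, w \in vertices L & w \notin corners].
Proof.
rewrite interior_facesE // => /andP[sL /fsubsetPn[w ws wB]]; exists w; split=> //.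
exact: (fsubsetP (face_vertices sL)).
Qed.

(** Together with [star_perm], this writes [K] and [K'] as disjoint unions
    with a common part and with parts indexed without repetition, so that sums
    over faces can be compared. *)
Lemma step_perm : perm_eq K'
  ([seq rho <- K | ~~ (sigma `<=` rho)] ++
   [seq psi @` s `|` theta | s <- interior_faces, theta <- link K sigma]).
Proof.
have intL s : s \in interior_faces -> s \in L.
  by rewrite interior_faceP => /andP[].
have newfaceP := @allpairsP _ _ _
  (fun (s : {fset 'rV[R]_k.+1}) (theta : {fset V}) => psi @` s `|` theta).
apply: uniq_perm; first exact: fset_uniq.
  rewrite cat_uniq filter_uniq ?fset_uniq // andTb; apply/andP; split.
    apply/hasPn => _ /newfaceP[[s theta] /= [sI tl ->]].
    rewrite mem_filter; apply/negP => /andP[_ rK].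
    have [w [ws wL wB]] := interior_face_vertex sI.
    case/negP: (psi_notin wL wB); apply: (fsubsetP (face_vertices rK)).
    by rewrite psi_mem ?intL.
  apply: (@allpairs_uniq _ _ _
    (fun (s : {fset 'rV[R]_k.+1}) (theta : {fset V}) => psi @` s `|` theta));
    rewrite ?fset_uniq //.
  move=> [s t] [s' t'] /allpairsP[[a b] /= [aI bl [-> ->]]].
  case/allpairsP=> [[a' b'] /= [aI' bl' [-> ->]]] rE; congr (_, _).
    apply/fsetP => w; case: (boolP (w \in vertices L)) => wL.
      by rewrite -(psi_mem (intL _ aI) bl wL) rE psi_mem ?intL.
    have nw c : c \in interior_faces -> w \notin c.
      by move/intL/face_vertices => xL; apply: contra wL; apply: (fsubsetP xL).
    by rewrite (negPf (nw _ aI)) (negPf (nw _ aI')).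
  have bE c y : c \in interior_faces -> y \in link K sigma ->
      (psi @` c `|` y) `\` psi @` vertices L = y.
    move=> xI yl; apply/fsetP => v; rewrite in_fsetD in_fsetU.
    case: (boolP (v \in psi @` vertices L)) => [|vN] /=.
      by case/imfsetP => w /= wL ->; rewrite (negPf (link_psi_disjoint yl wL)).
    case: (boolP (v \in psi @` c)) => //= /imfsetP[w /= wx vE].
    case/imfsetP: vN; exists w => //=.
    exact: (fsubsetP (face_vertices (intL _ xI))).
  by rewrite -(bE a b) // rE bE.
move=> rho; rewrite mem_cat mem_filter.
apply/step_memP/orP => [[[rK sr]|[s [theta [sI tl ->]]]]|].
- by left; rewrite sr.
- by right; apply/newfaceP; exists (s, theta).
case=> [/andP[sr rK]|/newfaceP[[s theta] /= [sI tl ->]]]; first by left.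
by right; exists s, theta.
Qed.

Lemma step_complex : simplicial_complex K'.
Proof.
split.
  apply/step_memP; left; split; first exact: K_complex.1.
  by rewrite fsubset0 -cardfs_eq0 card_sigma.
move=> rho rho' /step_memP[[rK sr]|[s [theta [sI tl ->]]]] sub.
  apply/step_memP; left; split; first exact: K_complex.2 rK sub.
  by apply: contra sr => sr; apply: fsubset_trans sr sub.
have sL : s \in L by move: sI; rewrite interior_faceP => /andP[].
pose s' := [fset w in s | psi w \in rho'].
pose theta' := rho' `&` theta.
have rE : rho' = psi @` s' `|` theta'.
  apply/fsetP => x; rewrite !inE; apply/idP/orP => [xr|].
    have := fsubsetP sub x xr; rewrite inE => /orP[/imfsetP[w /= ws xE]|xt].
      by left; apply/imfsetP; exists w; rewrite //= !inE ws -xE.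
    by right; rewrite xr.
  by case=> [/imfsetP[w /=]|/andP[]//]; rewrite !inE => /andP[_ ?] ->.
rewrite K'E in_fsetU; apply/orP; right; apply/imfset2P; exists s'.
  apply: (L_down sL).
  by apply/fsubsetP => w; rewrite !inE => /andP[].
exists theta' => //=; case/linkP: tl => tK dis stK; apply/linkP; split.
- by apply: K_complex.2 tK _; apply: fsubsetIr.
- by apply: fdisjointWr dis; apply: fsubsetIr.
- by apply: K_complex.2 stK _; apply: fsetUS; apply: fsubsetIr.
Qed.

Lemma step_vertices : vertices K `<=` vertices K'.
Proof.
apply/fsubsetP => v /verticesP[rho rK vr]; apply/verticesP; exists [fset v].
  apply/step_memP; left; split.
    by apply: K_complex.2 rK _; rewrite fsub1set.
  apply/negP => /fsubset_leq_card; rewrite card_sigma cardfs1.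
  by move: k_gt0; case: (k).
by rewrite inE.
Qed.

(** Iterated, this shows that old vertices of one face always come from a
    single face of the original complex, and that an original [k]-face never
    reappears once it has been subdivided. *)
Lemma step_old (V0 : {fset V}) rho : V0 `<=` vertices K -> rho \in K' ->
  exists2 rho0, rho0 \in K & rho `&` V0 `<=` rho0.
Proof.
move=> V0K /step_memP[[rK _]|[s [theta [sI /[dup] tl /linkP[_ _ stK] ->]]]].
  by exists rho => //; apply: fsubsetIl.
exists (sigma `|` theta) => //; apply/fsubsetP => x; rewrite !inE.
case/andP=> /orP[/imfsetP[w /= ws ->]|->] xV; last by rewrite orbT.
have wL : w \in vertices L.
  apply: (fsubsetP (face_vertices _)) ws.
  by move: sI; rewrite interior_faceP => /andP[].
rewrite psi_in_sigma //; case: (boolP (w \in corners)) => //= wB.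
by case/negP: (psi_notin wL wB); apply: (fsubsetP V0K).
Qed.

Lemma step_avoid rho : rho \in K' -> ~~ (sigma `<=` rho).
Proof.
case/step_memP => [[]//|[s [theta [sI tl ->]]]]; apply/negP => sub.
have sL : s \in L by move: sI; rewrite interior_faceP => /andP[].
have : corners `<=` s.
  apply/fsubsetP => w wB; have wL := fsubsetP corners_vertices w wB.
  by rewrite -(psi_mem sL tl wL); apply: (fsubsetP sub); rewrite psi_in_sigma.
move/(L_down sL) => BL.
by have := corners_notin; rewrite BL.
Qed.

Section Weights.
Variables (A : comNzRingType) (y : A) (P : nat -> A) (V0 : {fset V}).
Hypothesis P_rec : forall m, P (k.+1 + m)%N =
  \sum_(s <- interior_faces)
    y ^+ #|` s `\` corners| * P (#|` s `&` corners| + m)%N.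

(** The new vertices are counted with weight [y]; for the old ones, [P]
    anticipates all further subdivisions. *)
Definition old_weight rho : A := y ^+ #|` rho `\` V0| * P #|` rho `&` V0|.

(** The faces removed and added both factor through the link of [sigma], and
    for each face [theta] of the link the balance is the recurrence for [P] at
    [m = #|theta `&` V0|]. *)
Lemma step_weight : V0 `<=` vertices K -> sigma `<=` V0 ->
  \sum_(rho <- K') old_weight rho = \sum_(rho <- K) old_weight rho.
Proof.
move=> V0K sV0; rewrite (perm_big _ step_perm) (perm_big _ star_perm) /=.
rewrite !big_cat; congr (_ + _); rewrite big_allpairs_dep big_map exchange_big /=.
apply: eq_big_seq => theta tl.
have /linkP[tK /fdisjointP dis _] := tl.
have -> : old_weight (sigma `|` theta) =
    y ^+ #|` theta `\` V0| * P (k.+1 + #|` theta `&` V0|)%N.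
  rewrite /old_weight fsetDUl (_ : sigma `\` V0 = fset0) ?fset0U; last first.
    by apply/eqP; rewrite fsetD_eq0.
  have /fsetIidPl sIV0 := sV0; rewrite fsetIUl sIV0 cardfsU card_sigma.
  rewrite (_ : sigma `&` (theta `&` V0) = fset0) ?cardfs0 ?subn0 //.
  apply/fsetP => x; rewrite !inE; case: (boolP (x \in sigma)) => //= /dis.
  by move/negPf->.
rewrite P_rec mulr_sumr.
apply: (@eq_big_seq A 0 +%R {fset 'rV[R]_k.+1}) => s sI.
have sL : s \in L by move: sI; rewrite interior_faceP => /andP[].
have sV := fsubsetP (face_vertices sL).
have psiV0 w : w \in s -> (psi w \in V0) = (w \in corners).
  move=> ws; have wL := sV w ws; apply/idP/idP => [wV|wB].
    case: (boolP (w \in corners)) => // wB; case/negP: (psi_notin wL wB).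
    exact: (fsubsetP V0K).
  by apply: (fsubsetP sV0); rewrite psi_in_sigma.
have card_psi s' : s' `<=` s -> #|` psi @` s'| = #|` s'|.
  move=> ss; rewrite card_in_imfset //= => v w vs ws.
  by apply: psi_inj; apply: sV; apply: (fsubsetP ss).
have disj s' t' : s' `<=` s -> t' `<=` theta -> psi @` s' `&` t' = fset0.
  move=> ss tt; apply/fsetP => x; rewrite !inE; apply/negP => /andP[].
  move=> /imfsetP[w /= ws ->] wt.
  have := link_psi_disjoint tl (sV w (fsubsetP ss w ws)).
  by rewrite (fsubsetP tt _ wt).
rewrite /old_weight mulrCA mulrA -exprD; congr (y ^+ _ * P _).
  rewrite (_ : (psi @` s `|` theta) `\` V0
             = psi @` (s `\` corners) `|` (theta `\` V0)).
    by rewrite cardfsU disj ?fsubsetDl // cardfs0 subn0 card_psi ?fsubsetDl.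
  rewrite fsetDUl; congr (_ `|` _); apply/fsetP => x; rewrite in_fsetD.
  apply/andP/imfsetP => [[xN /imfsetP[w /= ws xE]]|[w /=]].
    by exists w => //=; rewrite in_fsetD ws -psiV0 // -xE xN.
  rewrite in_fsetD => /andP[wB ws] ->; rewrite psiV0 //; split=> //.
  by apply/imfsetP; exists w.
rewrite (_ : (psi @` s `|` theta) `&` V0
           = psi @` (s `&` corners) `|` (theta `&` V0)).
  by rewrite cardfsU disj ?fsubsetIl // cardfs0 subn0 card_psi ?fsubsetIl.
rewrite fsetIUl; congr (_ `|` _); apply/fsetP => x; rewrite in_fsetI.
apply/andP/imfsetP => [[/imfsetP[w /= ws xE] xV]|[w /=]].
  by exists w => //=; rewrite in_fsetI ws -psiV0 // -xE xV.
rewrite in_fsetI => /andP[ws wB] ->; rewrite psiV0 //; split=> //.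
by apply/imfsetP; exists w.
Qed.

End Weights.
End OneStep.

(** * Triangulations: the order of the steps does not matter *)

Section Invariant.
Variable V : choiceType.
Implicit Types (K : {fset {fset V}}) (rho : {fset V}).
Variables (A : comNzRingType) (y : A) (P : nat -> A).
Hypothesis P_rec : forall m, P (k.+1 + m)%N =
  \sum_(s <- interior_faces)
    y ^+ #|` s `\` corners| * P (#|` s `&` corners| + m)%N.
Hypothesis P_small : forall m, (m <= k)%N -> P m = y ^+ m.

(** The invariance of [old_weight], read at the two ends of the chain of
    steps.  The right-hand side does not mention the triangulation. *)
Lemma triangulation_sum K K' : simplicial_complex K ->
  tchebyshev_triangulation L K K' ->
  \sum_(rho <- K') y ^+ #|` rho| = \sum_(rho <- K) P #|` rho|.
Proof.
move=> K_complex [s [Ks [[s_uniq s_mem] [Ks0 Ksm] Ks_complex Ks_step]]].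
pose V0 := vertices K.
have s_face i : (i < size s)%N ->
    nth fset0 s i \in K /\ #|` nth fset0 s i| = k.+1.
  move=> im; have : nth fset0 s i \in s by rewrite mem_nth.
  by rewrite s_mem !inE => /andP[-> /eqP].
have inv i : (i <= size s)%N ->
  [/\ V0 `<=` vertices (Ks i),
      forall rho, rho \in Ks i -> rho `&` V0 \in K,
      forall j rho, (j < i)%N -> rho \in Ks i -> ~~ (nth fset0 s j `<=` rho) &
      \sum_(rho <- Ks i) old_weight y P V0 rho
        = \sum_(rho <- K) old_weight y P V0 rho].
  elim: i => [_|i IH im].
    rewrite Ks0; split=> // rho rK; apply: K_complex.2 rK _; exact: fsubsetIl.
  have [VKi oldKi avoidKi sumKi] := IH (ltnW im).
  have [psi [psi_inj psi_sigma psi_new KsE]] := Ks_step i im.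
  have Ki_complex := Ks_complex i (ltnW im).
  have [sK _] := s_face i im.
  have old rho : rho \in Ks i.+1 ->
      exists2 rho0, rho0 \in Ks i & rho `&` V0 `<=` rho0.
    by move=> rK; eapply step_old; eassumption.
  split.
  - apply: fsubset_trans VKi _.
    by eapply step_vertices; eassumption.
  - move=> rho /old[rho0 r0K sub].
    apply: K_complex.2 (oldKi _ r0K) _.
    by rewrite fsubsetI sub fsubsetIr.
  - move=> j rho; rewrite ltnS leq_eqVlt => /orP[/eqP->|ji] rK.
      by eapply step_avoid; eassumption.
    have [rho0 r0K sub] := old _ rK.
    apply: contra (avoidKi j rho0 ji r0K) => sj; apply: fsubset_trans sub.
    rewrite fsubsetI sj; apply: face_vertices.
    exact: (s_face j (ltn_trans ji im)).1.
  - rewrite -sumKi.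
    have sV0 := face_vertices sK.
    by eapply step_weight; eassumption.
have [_ oldK' avoidK' sumK'] := inv (size s) (leqnn _).
rewrite Ksm in oldK' avoidK' sumK'.
transitivity (\sum_(rho <- K') old_weight y P V0 rho).
  apply: (@eq_big_seq A 0 +%R {fset V}) => rho rK.
  rewrite /old_weight P_small; first by rewrite -exprD addnC cardfsID.
  (* More than k old vertices would include an original k-face, and every such
     face has been subdivided. *)
  rewrite leqNgt; apply/negP => /subset_of_card[tau tr tk].
  have tK : tau \in K by apply: K_complex.2 (oldK' _ rK) tr.
  have ts : tau \in s by rewrite s_mem !inE tK tk eqxx.
  have im : (index tau s < size s)%N by rewrite index_mem.
  have /negP := avoidK' _ _ im rK; rewrite nth_index //; apply.
  exact: fsubset_trans tr (fsubsetIl _ _).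
rewrite sumK'; apply: (@eq_big_seq A 0 +%R {fset V}) => rho rK.
have rV := face_vertices rK.
have /fsetIidPl rE := rV; rewrite /old_weight rE.
have -> : rho `\` V0 = fset0 by apply/eqP; rewrite fsetD_eq0.
by rewrite cardfs0 mul1r.
Qed.

End Invariant.

Section Existence.
Implicit Types (K : {fset {fset nat}}).

(** The natural numbers always leave room for new vertices. *)
Lemma step_exists K (sigma : {fset nat}) :
  simplicial_complex K -> #|` sigma| = k.+1 ->
  exists2 K', simplicial_complex K' & tchebyshev_step L K sigma K'.
Proof.
move=> K_complex sk.
pose N := (\max_(i <- vertices K `|` sigma) i).+1.
have ltN (x : nat) : x \in vertices K `|` sigma -> (x < N)%N.
  by move=> xs; rewrite /N ltnS; apply: (@leq_bigmax_seq _ _ predT id).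
pose psi w := if w \in corners then nth 0%N sigma (index w corners)
              else (N + index w (vertices L))%N.
have sB : #|` sigma| = #|` corners| by rewrite sk card_corners.
have nth_sigma w : w \in corners -> nth 0%N sigma (index w corners) \in sigma.
  by move=> wB; rewrite mem_nth // -/(#|` sigma|) sB index_mem.
have psiB w : w \in corners -> (psi w < N)%N.
  by move=> wB; rewrite /psi wB ltN // inE nth_sigma ?orbT.
have psi_inj : {in vertices L &, injective psi}.
  move=> v w vL wL; have := psiB v; have := psiB w; rewrite /psi.
  case: (boolP (v \in corners)) => vB; case: (boolP (w \in corners)) => wB;
    try by lia.
    move=> _ _ /eqP; rewrite nth_uniq ?fset_uniq //.
    - by move=> /eqP; apply: index_inj.
    - by rewrite -/(#|` sigma|) sB index_mem.
    - by rewrite -/(#|` sigma|) sB index_mem.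
  by move=> _ _ /addnI; apply: index_inj.
have psi_sigma : psi @` vertices (boundary_complex L) = sigma.
  rewrite vertices_boundary //; apply/eqP; rewrite eqEfcard; apply/andP; split.
    by apply/fsubsetP => _ /imfsetP[w /= wB ->]; rewrite /psi wB nth_sigma.
  rewrite sk card_in_imfset /= ?card_corners // => v w vB wB.
  by apply: psi_inj; apply: (fsubsetP corners_vertices).
have psi_new w : w \in interior_vertices L -> psi w \notin vertices K.
  rewrite interior_verticesE // inE => /andP[wB _]; rewrite /psi (negPf wB).
  by apply/negP => wK; have := ltN _ (fsubsetP (fsubsetUl _ _) _ wK); lia.
eexists; last by exists psi; split; [exact: psi_inj| | |reflexivity].
by eapply step_complex; try eassumption; reflexivity.
Qed.

Lemma steps_exist (s : seq {fset nat}) K : simplicial_complex K ->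
  (forall sigma : {fset nat}, sigma \in s -> #|` sigma| = k.+1) ->
  exists Ks : nat -> {fset {fset nat}},
    [/\ Ks 0%N = K, forall i, (i <= size s)%N -> simplicial_complex (Ks i) &
        forall i, (i < size s)%N ->
          tchebyshev_step L (Ks i) (nth fset0 s i) (Ks i.+1)].
Proof.
elim: s K => [|sigma s IH] K K_complex s_card.
  by exists (fun=> K); split.
have [K1 K1_complex step1] := step_exists K_complex (s_card _ (mem_head _ _)).
have [|Ks [Ks0 Ks_complex Ks_step]] := IH K1 K1_complex.
  by move=> tau ts; apply: s_card; rewrite inE ts orbT.
exists (fun i => if i is j.+1 then Ks j else K); split=> //.
  by case=> [|i] //=; apply: Ks_complex.
by case=> [|i] /=; [rewrite Ks0 | apply: Ks_step].
Qed.

Lemma triangulation_exists K : simplicial_complex K ->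
  exists K', tchebyshev_triangulation L K K'.
Proof.
move=> K_complex; have [|Ks [Ks0 Ks_complex Ks_step]] :=
  @steps_exist (faces_card K k.+1) K K_complex.
  by move=> sigma; rewrite !inE => /andP[_ /eqP].
exists (Ks (size (faces_card K k.+1))), (faces_card K k.+1), Ks.
by split=> //; split=> //; exact: fset_uniq.
Qed.

End Existence.

(** * The linear map and its recurrence *)

Local Notation y := (half_shift R).

(** In [{poly {poly R}}] the inner variable is [x]; the outer one plays [w]
    for the reduction and [t] for the reversed polynomial.  This is
    [(w - 1) / 2]. *)
Definition outer_shift : {poly {poly R}} := (2^-1)%:P *: ('X - 1).
Local Notation Z := outer_shift.

Lemma map_half_shift : map_poly polyC y = Z.
Proof. by rewrite /half_shift map_polyZ rmorphB /= map_polyX rmorph1. Qed.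

Lemma size_outer_exp n : (size (Z ^+ n) <= n.+1)%N.
Proof.
apply: leq_trans (size_poly_exp_leq _ _) _; rewrite ltnS.
have : (size Z <= 2)%N.
  apply: leq_trans (size_scale_leq _ _) _.
  by rewrite -[1]/(1%:P) size_XsubC.
by move: (size Z) => s; nia.
Qed.

(** The power of [2] makes the polynomial monic in [w]. *)
Definition reduction_poly : {poly {poly R}} :=
  - ((2 ^+ k.+1)%:P *: magic_poly L Z y%:P).
Local Notation G := reduction_poly.

Lemma magic_reduction_poly : magic_poly L Z y%:P = - ((2^-1 ^+ k.+1)%:P *: G).
Proof.
rewrite /reduction_poly scalerN opprK scalerA -polyCM -exprMn mulVf ?expr1n.
  by rewrite scale1r.
by rewrite pnatr_eq0.
Qed.

Lemma card_interior_corners s :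
  s \in interior_faces -> (#|` s `&` corners| <= k)%N.
Proof.
rewrite interior_faceP => /andP[sL _]; rewrite -ltnS.
suff /fproper_ltn_card : s `&` corners `<` corners by rewrite card_corners.
rewrite fproperEneq fsubsetIr andbT; apply/eqP => sB.
have := corners_notin.
by rewrite (L_down sL) // -sB fsubsetIl.
Qed.

Lemma magic_polyZE : magic_poly L Z y%:P =
  \sum_(s <- interior_faces) y ^+ #|` s `\` corners| *: Z ^+ #|` s `&` corners|
    - Z ^+ k.+1.
Proof.
rewrite magic_polyE //; congr (_ - _); apply: eq_bigr => s _.
by rewrite /weight -polyC_exp mulrC mul_polyC.
Qed.

Lemma reduction_polyE : exists2 p : {poly {poly R}}, (size p <= k.+1)%N &
  G = ('X - 1%:P) ^+ k.+1 + p.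
Proof.
exists (- ((2 ^+ k.+1)%:P *: \sum_(s <- interior_faces)
          y ^+ #|` s `\` corners| *: Z ^+ #|` s `&` corners|)).
  rewrite size_polyN; apply: leq_trans (size_scale_leq _ _) _.
  rewrite big_seq; elim/big_rec: _ => [|s p sI IH]; first by rewrite size_poly0.
  apply: leq_trans (size_polyD _ _) _; rewrite geq_max IH andbT.
  apply: leq_trans (size_scale_leq _ _) _.
  by apply: leq_trans (size_outer_exp _) _; rewrite ltnS card_interior_corners.
rewrite /reduction_poly magic_polyZE scalerBr opprB; congr (_ + _).
rewrite /outer_shift exprZn scalerA -polyC_exp -polyCM -exprMn mulfV ?expr1n.
  by rewrite scale1r.
by rewrite pnatr_eq0.
Qed.

Lemma reduction_poly_monic : G \is monic.
Proof.
have [p sp ->] := reduction_polyE; rewrite monicE lead_coefDl.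
  by rewrite -monicE monic_exp // monicXsubC.
by rewrite size_exp_XsubC ltnS.
Qed.

Lemma size_reduction_poly : size G = k.+2.
Proof.
by have [p sp ->] := reduction_polyE; rewrite size_polyDl size_exp_XsubC // ltnS.
Qed.

(** Remainder, then [w = x].  Reduction is linear over [{poly R}], and it
    kills the multiples of [G]. *)
Definition reduce (p : {poly {poly R}}) : {poly R} := (rmodp p G).['X].

Lemma reduceD p q : reduce (p + q) = reduce p + reduce q.
Proof. by rewrite /reduce rmodpD ?reduction_poly_monic // hornerD. Qed.

Lemma reduceZ a p : reduce (a *: p) = a * reduce p.
Proof. by rewrite /reduce rmodpZ ?reduction_poly_monic // hornerZ. Qed.

Lemma reduce_small (p : {poly {poly R}}) :
  (size p <= k.+1)%N -> reduce p = p.['X].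
Proof. by move=> sp; rewrite /reduce rmodp_small // size_reduction_poly ltnS. Qed.

Lemma reduce_sum (I : Type) (r : seq I) (F : I -> {poly {poly R}}) :
  reduce (\sum_(i <- r) F i) = \sum_(i <- r) reduce (F i).
Proof.
elim/big_rec2: _ => [|i p q _ <-]; last exact: reduceD.
by rewrite reduce_small ?size_poly0 // horner0.
Qed.

Lemma reduce_mul p : reduce (p * G) = 0.
Proof. by rewrite /reduce rmodp_mull ?reduction_poly_monic // horner0. Qed.

Lemma reduce_Z_small m : (m <= k)%N -> reduce (Z ^+ m) = y ^+ m.
Proof.
move=> mk; rewrite reduce_small; last exact: leq_trans (size_outer_exp m) _.
by rewrite horner_exp /outer_shift hornerZ !hornerE mul_polyC.
Qed.

(** The image of [Z ^+ m * magic_poly L Z y%:P], a multiple of [G]. *)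
Lemma reduce_Z_rec m : reduce (Z ^+ (k.+1 + m)) =
  \sum_(s <- interior_faces)
    y ^+ #|` s `\` corners| * reduce (Z ^+ (#|` s `&` corners| + m)).
Proof.
have : reduce (Z ^+ m * magic_poly L Z y%:P) = 0.
  rewrite magic_reduction_poly -scalerN -scalerAr mulrN -mulNr reduceZ.
  by rewrite reduce_mul mulr0.
rewrite magic_polyZE mulrBr mulr_sumr -scaleN1r reduceD reduceZ reduce_sum mulN1r.
move/eqP; rewrite subr_eq0 => /eqP; rewrite -exprD addnC => <-.
by apply: eq_bigr => s _; rewrite -scalerAr reduceZ -exprD addnC.
Qed.

Lemma reduce_X_small n : (n <= k)%N -> reduce 'X^n = 'X^n.
Proof. by move=> nk; rewrite reduce_small ?size_polyXn ?ltnS // hornerXn. Qed.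

(** The image of ['X^(n - k.+1) * G], expanded along the coefficients of [G]. *)
Lemma reduce_X_rec n : (k.+1 <= n)%N -> reduce 'X^n =
  \sum_(1 <= j < k.+2) - G`_(k.+1 - j) * reduce 'X^(n - j).
Proof.
move=> kn; have : reduce ('X^(n - k.+1) * G) = 0 by rewrite reduce_mul.
rewrite -[X in _ * X]coefK size_reduction_poly poly_def mulr_sumr reduce_sum.
rewrite (reindex_inj rev_ord_inj) /=.
under eq_bigr => i _ do rewrite -scalerAr reduceZ -exprD subSS.
rewrite -(big_mkord predT
  (fun j => G`_(k.+1 - j) * reduce 'X^(n - k.+1 + (k.+1 - j)))).
rewrite (@big_ltn _ _ _ 0%N) // subn0 subnK //.
have -> : G`_k.+1 = 1.
  by have /monicP := reduction_poly_monic; rewrite lead_coefE size_reduction_poly.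
rewrite mul1r => /eqP; rewrite addr_eq0 => /eqP ->.
rewrite -sumrN; apply: eq_big_nat => j /andP[_ jk].
by rewrite mulNr; congr (- (_ * reduce 'X^_)); lia.
Qed.

Definition reduce_map (p : {poly R}) : {poly R} := reduce (map_poly polyC p).

Lemma reduce_map_linear (a : R) (p q : {poly R}) :
  reduce_map (a *: p + q) = a *: reduce_map p + reduce_map q.
Proof.
by rewrite /reduce_map rmorphD /= map_polyZ reduceD reduceZ mul_polyC.
Qed.

Lemma reduce_map_is_tchebyshev : is_tchebyshev_map L reduce_map.
Proof.
split=> [a p q|V K K' K_complex tri]; first exact: reduce_map_linear.
rewrite !Fpoly_sum.
rewrite (triangulation_sum reduce_Z_rec reduce_Z_small K_complex tri).
rewrite /reduce_map rmorph_sum reduce_sum; apply: eq_bigr => rho _.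
by rewrite rmorphXn /= map_half_shift.
Qed.

Definition full_simplex n : {fset {fset nat}} := fpowerset [fset i in iota 0 n].

Lemma full_simplex_complex n : simplicial_complex (full_simplex n).
Proof.
split=> [|sigma tau]; rewrite !fpowersetE ?fsub0set // => ss ts.
exact: fsubset_trans ts ss.
Qed.

Lemma Fpoly_full_simplex n : Fpoly R (full_simplex n) = (1 + y) ^+ n.
Proof.
have prod_const (c : {poly R}) (S : {fset nat}) : \prod_(w <- S) c = c ^+ #|` S|.
  by rewrite big_const_seq count_predT iter_mulr_1.
rewrite Fpoly_sum; under eq_bigr => rho _ do rewrite -prod_const.
rewrite -(prod_add1 (fun=> y)) prod_const; congr (_ ^+ _).
by rewrite card_fseq undup_id ?iota_uniq // size_iota.
Qed.

(** The maps agree on the F-polynomials of full simplices, the powers of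
    [1 + y], and every polynomial in [x] is one in [1 + y = (1 + x) / 2]. *)
Lemma tchebyshev_map_unique (T : {poly R} -> {poly R}) :
  is_tchebyshev_map L T -> T =1 reduce_map.
Proof.
move=> [T_lin T_tri] p.
have [rT_lin rT_tri] := reduce_map_is_tchebyshev.
have linear_0 (S : {poly R} -> {poly R}) :
    (forall a p q, S (a *: p + q) = a *: S p + S q) -> S 0 = 0.
  move=> S_lin; have := S_lin (-1) 0 0; rewrite scaleN1r addr0 oppr0 => ->.
  by rewrite scaleN1r addNr.
have agree n : T ((1 + y) ^+ n) = reduce_map ((1 + y) ^+ n).
  rewrite -Fpoly_full_simplex.
  have Kc := full_simplex_complex n.
  have [K' tri] := triangulation_exists Kc.
  by rewrite (T_tri _ _ _ Kc tri) (rT_tri _ _ _ Kc tri).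
have -> : p = (p \Po (2 *: 'X - 1)) \Po (1 + y).
  rewrite -comp_polyA rmorphB /= comp_polyZ comp_polyX rmorph1.
  rewrite /half_shift scalerDr scalerA mulfV ?pnatr_eq0 // scale1r.
  rewrite [X in _ \Po X](_ : _ = 'X) ?comp_polyXr //.
  by rewrite scaler_nat; ring.
rewrite comp_polyE; elim/big_rec: _ => [|i q _ IH].
  by rewrite !linear_0.
by rewrite T_lin rT_lin agree IH.
Qed.

Lemma tchebyshev_polyE n : tchebyshev_poly L n = reduce 'X^n.
Proof.
rewrite /tchebyshev_poly /tchebyshev_map; case: pselect => [T_exists|noT].
  rewrite (tchebyshev_map_unique (projT2 (cid T_exists))).
  by rewrite /reduce_map map_polyXn.
by case: noT; exists reduce_map; exact: reduce_map_is_tchebyshev.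
Qed.

(** The reversal of [- G].  Its constant coefficient, of index [j = 0], is
    [-1]. *)
Definition recurrence_poly : {poly {poly R}} := \poly_(j < k.+2) - G`_(k.+1 - j).

(** Reversal is evaluation at [t^-1] followed by multiplication by
    [t ^+ k.+1].  The arguments of the magic polynomial that arise are
    [u = (t^-1 - 1) / 2] and [v = (x - 1) / 2]; the symmetry turns them into [-1 - u] and
    [-1 - v] and its sign turns [2 t] into [-2 t]. *)
Lemma recurrence_polyE :
  let t : {fraction {poly {poly R}}} := tofrac 'X in
  let x : {fraction {poly {poly R}}} := tofrac ('X)%:P in
  tofrac recurrence_poly = (- 2 * t) ^+ k.+1
     * magic_poly L (- ((1 + t) / (2 * t))) (- ((1 + x) / 2)).
Proof.
move=> t x.
have tE : tofrac 'X = t by [].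
have xE : tofrac ('X)%:P = x by [].
(* Opaque t and x keep unification from unfolding the fraction field. *)
clearbody t x.
have t0 : t != 0 by rewrite -tE tofrac_eq0 polyX_eq0.
have two0 : (2 : {fraction {poly {poly R}}}) != 0.
  rewrite -(rmorph_nat (@tofrac {poly {poly R}})) tofrac_eq0.
  by rewrite -!polyC_natr !polyC_eq0 pnatr_eq0.
have [phi phiE] : {phi : {rmorphism {poly R} -> {fraction {poly {poly R}}}} |
    forall c, phi c = tofrac c%:P}.
  by exists (@tofrac {poly {poly R}} \o @polyC {poly R})%FUN.
have [ev evE] : {ev : {rmorphism {poly {poly R}} -> {fraction {poly {poly R}}}} |
    forall p, ev p = (map_poly phi p).[t^-1]}.
  by exists (horner_eval t^-1 \o map_poly phi)%FUN.
have phi_half : phi (2^-1)%:P = 2^-1 by rewrite phiE tofrac_half.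
have evZ : ev Z = (t^-1 - 1) / 2.
  rewrite evE /outer_shift map_polyZ rmorphB /= map_polyX rmorph1.
  by rewrite hornerZ !hornerE phi_half mulrC.
have evy : ev y%:P = (x - 1) / 2.
  have -> : y = (2^-1)%:P * ('X - 1) by rewrite mul_polyC.
  rewrite evE map_polyC hornerC /= rmorphM.
  by rewrite phi_half rmorphB rmorph1 phiE xE mulrC.
rewrite -(add1_half_inv t0 two0) -(add1_half x two0) -evZ -evy.
have evG : tofrac recurrence_poly = - (t ^+ k.+1 * ev G).
  rewrite evE (horner_coef_wide (n := k.+2)); last first.
    by apply: leq_trans (size_poly _ _) _; rewrite size_reduction_poly.
  rewrite (reindex_inj rev_ord_inj) mulr_sumr -sumrN /recurrence_poly poly_def.
  rewrite rmorph_sum; apply: eq_bigr => i _ /=; rewrite coef_map subSS.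
  rewrite -mul_polyC rmorphM rmorphXn /= tE -phiE rmorphN mulNr mulrCA.
  congr (- (_ * _)).
  have ik : (i <= k.+1)%N by rewrite -ltnS ltn_ord.
  by have <- := expr_inv_sub t0 ik.
rewrite magic_poly_symmetry // -magic_poly_rmorph magic_reduction_poly // rmorphN.
have -> : ev ((2^-1 ^+ k.+1)%:P *: G) = 2^-1 ^+ k.+1 * ev G.
  rewrite -mul_polyC rmorphM evE map_polyC hornerC /= polyC_exp; congr (_ * _).
  by rewrite rmorphXn /= phi_half.
by rewrite evG mulrA -exprMn mulrN mulrA -exprMn mulN2N1_half.
Qed.

End Triangulation.

(* p_j is the coefficient q`_j of t^j in q, an element of R[x][t] equal, in the
   fraction field of R[x][t], to the displayed expression. *)
Theorem theorem5p5 (R : realType) (k : nat) (L : {fset {fset 'rV[R]_k.+1}})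
    (k_gt0 : (0 < k)%N)
    (L_triangulation : simplex_triangulation L)
    (L_boundary : forall v, v \in vertices L -> simplex_boundary v ->
       exists i : 'I_k.+1, v = delta_mx 0 i)
    (L_interior : exists2 v, v \in vertices L & simplex_interior v) :
  (forall n, (n <= k)%N -> tchebyshev_poly L n = 'X^n) /\
  exists q : {poly {poly R}},
    (let t : {fraction {poly {poly R}}} := tofrac 'X in
     let x : {fraction {poly {poly R}}} := tofrac ('X)%:P in
     tofrac q = (- 2 * t) ^+ k.+1
                * magic_poly L (- ((1 + t) / (2 * t))) (- ((1 + x) / 2))) /\
    forall n, (k.+1 <= n)%N ->
      tchebyshev_poly L n
        = \sum_(1 <= j < k.+2) q`_j * tchebyshev_poly L (n - j).

Proof.
split=> [n nk|]; first by rewrite tchebyshev_polyE // reduce_X_small.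
exists (recurrence_poly L); split; first exact: recurrence_polyE.
move=> n kn; rewrite tchebyshev_polyE // reduce_X_rec //.
apply: eq_big_nat => j /andP[_ jk].
by rewrite tchebyshev_polyE // coef_poly jk.
Qed.
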